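(* Let $\gamma(z,p)=\sum_{\ell=1}^L [p\cdot G_\ell(z)p]^{1/2}$ with each $G_\ell(z)\in\mathbb{R}^{3\times3}$ symmetric and positive definite. Let $\Psi(s)=\tfrac14(1-s^2)^2$, $\phi^+(s)=s^3$ and $\phi^-(s)=-s$ for $s\in\mathbb{R}$. Let $n\ge1$, $\tau_n>0$, $\Phi^{n-1}\in S^h$ (with $\Phi^0\in K^h$ when $n=1$) and, if $\vartheta>0$, $W^{n-1}\in S^h_D$ be given. Then there exists a unique $(\Phi^n,W^n)\in S^h\times S^h_D$ such that $$\vartheta\Big\langle\frac{W^n-W^{n-1}}{\tau_n},\chi\Big\rangle^h_{\mathcal{M}^h}+\tfrac12\lambda\Big\langle\frac{\Phi^n-\Phi^{n-1}}{\tau_n},\chi\Big\rangle^h_{\mathcal{M}^h}+\langle\mathcal{K}\nabla_s W^n,\nabla_s\chi\rangle^h_{\mathcal{M}^h}=0\qquad\forall\,\chi\in S^h_0,$$ $$\varepsilon\frac{\rho}{\alpha}\Big\langle\mu(\cdot,\nabla_s\Phi^{n-1})\frac{\Phi^n-\Phi^{n-1}}{\tau_n},\chi\Big\rangle^h_{\mathcal{M}^h}+\varepsilon\langle B(\cdot,\nabla_s\Phi^{n-1})\nabla_s\Phi^n,\nabla_s\chi\rangle^h_{\mathcal{M}^h}+\varepsilon^{-1}\langle\phi^+(\Phi^n),\chi\rangle^h_{\mathcal{M}^h}=\Big\langle\tfrac12 c_\Psi\frac{a}{\alpha}W^n-\varepsilon^{-1}\phi^-(\Phi^{n-1}),\chi\Big\rangle^h_{\mathcal{M}^h}\qquad\forall\,\chi\in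 S^h.$$ Moreover, this solution satisfies the stability bound $$\mathcal{F}^h(W^n,\Phi^n)+\tau_n\langle\mathcal{K}\nabla_sW^n,\nabla_sW^n\rangle^h_{\mathcal{M}^h}+\tau_n\frac{\lambda\rho}{a}\frac{\varepsilon}{c_\Psi}\Big|[\mu(\cdot,\nabla_s\Phi^{n-1})]^{1/2}\,\frac{\Phi^n-\Phi^{n-1}}{\tau_n}\Big|_h^2\ \le\ \mathcal{F}^h(W^{n-1},\Phi^{n-1}).$$
   Context: Surface and mesh. $\mathcal{M}^h\subset\mathbb{R}^3$ is a polyhedral hypersurface, with or without boundary, $\mathcal{M}^h=\bigcup_{\sigma\in\mathcal{T}^h}\overline{\sigma}$ for a finite (conforming) triangulation $\mathcal{T}^h$ into open nondegenerate flat triangles, with nodes $\{p_j\}_{j\in J}$. $\partial_D\mathcal{M}^h\subset\partial\mathcal{M}^h$ is a (possibly empty) union of boundary edges. $\nabla_s$ is the surface gradient on $\mathcal{M}^h$, defined on each triangle (so it is piecewise constant, with values in the plane of the triangle, for piecewise affine functions). Finite element spaces. $S^h=\{\chi\in C(\mathcal{M}^h):\chi|_\sigma \text{ is affine for all }\sigma\in\mathcal{T}^h\}$, $K^h=\{\chi\in S^h:|\chi|\le1\}$, $S^h_0=\{\chi\in S^h:\chi=0\text{ on }\partial_D\mathcal{M}^h\}$, $S^h_D=\{\chi\in S^h:\chi=w_D\text{ on }\partial_D\mathcal{M}^h\}$, with $w_D\in\mathbb{R}$ a fixed constant. Discrete semi-inner product (mass lumping). For piecewise continuous functions, $\langle\eta_1,\eta_2\rangle^h_{\mathcal{M}^h}=\sum_{\sigma\in\mathcal{T}^h}\tfrac13|\sigma|\sum_{k=0}^2(\eta_1\eta_2)((p_{j_k})^-)$,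 where $p_{j_0},p_{j_1},p_{j_2}$ are the vertices of $\sigma$, $|\sigma|$ is its area and $\eta((p_{j_k})^-)=\lim_{\sigma\ni q\to p_{j_k}}\eta(q)$; for vector-valued functions the product is the Euclidean dot product. $|\eta|_h=[\langle\eta,\eta\rangle^h_{\mathcal{M}^h}]^{1/2}$. Anisotropy. $G_\ell$, $\ell=1,\dots,L$ ($L\ge1$), are continuous functions of $z$ (evaluated on $\mathcal{M}^h$) with values in the symmetric positive definite matrices in $\mathbb{R}^{3\times3}$, $\gamma_\ell(z,p)=[p\cdot G_\ell(z)p]^{1/2}$ for $p\in\mathbb{R}^3$, $\gamma=\sum_{\ell=1}^L\gamma_\ell$, and $$B(z,q)=\begin{cases}\gamma(z,q)\sum_{\ell=1}^L[\gamma_\ell(z,q)]^{-1}G_\ell(z)& q\ne0,\\ L\sum_{\ell=1}^LG_\ell(z)& q=0.\end{cases}$$ The function $\mu$ takes strictly positive values $\mu(z,p)>0$ for $z$ on the surface and $p\in\mathbb{R}^3$, and is continuous in $z$. Parameters. $\varepsilon,\alpha,a,\lambda,\mathcal{K}>0$ and $\vartheta,\rho\ge0$ are real constants. If $\vartheta=0$, all terms multiplied by $\vartheta$ are absent (in particular $W^{n-1}$ plays no role). $c_\Psi=\int_{-1}^1\sqrt{2\Psi(s)}\,ds$. Energies. For $W,\Phi\in S^h$, $$\mathcal{E}^h(W,\Phi)=\frac{\vartheta}{2}|W-w_D|_h^2+\frac{\lambda\alpha}{a}\frac1{c_\Psi}\Big[\tfrac12\varepsilon|\gamma(\cdot,\nabla_s\Phi)|_h^2+\varepsilon^{-1}\langle\Psi(\Phi),1\rangle^h_{\mathcal{M}^h}\Big],\qquad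 \mathcal{F}^h(W,\Phi)=\mathcal{E}^h(W,\Phi)-\lambda w_D\langle\tfrac12,1+\Phi\rangle^h_{\mathcal{M}^h}.$$ *)

(* Defs.v *)
From HB Require Import structures.
From mathcomp Require Import all_boot all_order all_algebra.
From mathcomp Require Import all_classical all_reals all_analysis.

Set Implicit Arguments.
Unset Strict Implicit.
Unset Printing Implicit Defensive.

Import Order.TTheory GRing.Theory Num.Theory.
Import numFieldNormedType.Exports.
Local Open Scope classical_set_scope.
Local Open Scope ring_scope.

Notation vec3 R := 'cV[R]_3.

Definition dot (R : realType) (u v : vec3 R) : R :=
  \sum_(i < 3) u i 0 * v i 0.

Definition enorm (R : realType) (u : vec3 R) : R := Num.sqrt (dot u u).

Section Simplices.
Context (R : realType) (J : finType) (p : J -> vec3 R).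

Definition hull (A : {set J}) : set (vec3 R) :=
  [set x | exists t : J -> R,
     [/\ forall j, j \in A -> 0 <= t j,
         \sum_(j in A) t j = 1 & x = \sum_(j in A) t j *: p j]].

Definition open_simplex (A : {set J}) : set (vec3 R) :=
  [set x | exists t : J -> R,
     [/\ forall j, j \in A -> 0 < t j,
         \sum_(j in A) t j = 1 & x = \sum_(j in A) t j *: p j]].

End Simplices.

(* |(b - a) x (c - a)| / 2, the cross product being computed by Lagrange's
   identity. *)
Definition triangle_area (R : realType) (a b c : vec3 R) : R :=
  2^-1 * Num.sqrt (dot (b - a) (b - a) * dot (c - a) (c - a)
                   - dot (b - a) (c - a) ^+ 2).

Definition verts_of (J : finType) (v : 'I_3 -> J) : {set J} :=
  [set v k | k : 'I_3]%SET.

(* A finite conforming triangulation of a polyhedral hypersurface.  The fields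
   [edge_manifold] and [vertex_manifold] express that the union of the closed
   triangles is a surface, possibly with boundary: the link of every node is
   connected and has all its degrees at most 2, so is a path or a cycle. *)
Record mesh (R : realType) := Mesh {
  nodes : finType;
  triangles : finType;
  node : nodes -> vec3 R;
  vert : triangles -> 'I_3 -> nodes;
  node_inj : injective node;
  node_used : forall j, exists s, j \in verts_of (vert s);
  verts_inj : injective (fun s => verts_of (vert s));
  nondegenerate : forall s,
    0 < triangle_area (node (vert s 0)) (node (vert s 1)) (node (vert s 2%:R));
  conforming : forall s s',
    closure (open_simplex node (verts_of (vert s)))
      `&` closure (open_simplex node (verts_of (vert s')))
    = hull node (verts_of (vert s) :&: verts_of (vert s'))%SET;
  edge_manifold : forall e : {set nodes}, #|e| = 2%N ->
    (#|[pred s | e \subset verts_of (vert s)]| <= 2)%N;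
  vertex_manifold : forall j s s',
    j \in verts_of (vert s) -> j \in verts_of (vert s') ->
    connect [rel a b | (j \in verts_of (vert a) :&: verts_of (vert b))%SET
                       && (1 < #|(verts_of (vert a) :&: verts_of (vert b))%SET|)%N]
      s s'
}.

Section Surface.
Context (R : realType) (M : mesh R).

Definition verts (s : triangles M) : {set nodes M} := verts_of (vert s).

Definition tri (s : triangles M) : set (vec3 R) :=
  open_simplex (@node R M) (verts s).

Definition surface : set (vec3 R) :=
  \bigcup_(s in [set: triangles M]) closure (tri s).

Definition corner (s : triangles M) (k : 'I_3) : vec3 R := node (vert s k).

Definition area (s : triangles M) : R :=
  triangle_area (corner s 0) (corner s 1) (corner s 2%:R).

Definition boundary_edges : {set {set nodes M}} :=
  [set e : {set nodes M} |
     (#|e| == 2%N) && (#|[pred s | e \subset verts s]| == 1%N)]%SET.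

Definition edge_union (D : {set {set nodes M}}) : set (vec3 R) :=
  \bigcup_(e in [set e | e \in D]) hull (@node R M) e.

(* Orthonormal frame of the plane of a triangle (Gram-Schmidt). *)
Definition frame1 (s : triangles M) : vec3 R :=
  let e := corner s 1 - corner s 0 in (enorm e)^-1 *: e.

Definition frame2 (s : triangles M) : vec3 R :=
  let e := corner s 2%:R - corner s 0 in
  let e' := e - dot e (frame1 s) *: frame1 s in (enorm e')^-1 *: e'.

(* Surface gradient.  The open triangles are pairwise disjoint, so at most one
   is picked; the directional derivatives of [f] in tangential directions only
   depend on the values of [f] on that triangle.  The value off the open
   triangles is never used. *)
Definition sgrad (f : vec3 R -> R) (x : vec3 R) : vec3 R :=
  if [pick s | `[< tri s x >]] is Some s then
    'D_(frame1 s) f x *: frame1 s + 'D_(frame2 s) f x *: frame2 s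
  else 0.

Definition affine_on (A : set (vec3 R)) (f : vec3 R -> R) : Prop :=
  exists (g : vec3 R) (c : R), forall x, A x -> f x = dot g x + c.

(* Functions on the surface are functions on R^3 of which only the values on
   the surface matter. *)
Definition Sh : set (vec3 R -> R) :=
  [set f | {within surface, continuous f} /\ forall s, affine_on (tri s) f].

Definition Kh : set (vec3 R -> R) :=
  [set f | Sh f /\ forall x, surface x -> `|f x| <= 1].

Definition Sh_bc (D : {set {set nodes M}}) (c : R) : set (vec3 R -> R) :=
  [set f | Sh f /\ forall x, edge_union D x -> f x = c].

Definition trace_at (s : triangles M) (k : 'I_3) (f : vec3 R -> R) : R :=
  lim (f @ within (tri s) (nbhs (corner s k))).

Definition lumped (f : vec3 R -> R) : R :=
  \sum_(s : triangles M) 3^-1 * area s * \sum_(k < 3) trace_at s k f.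

Definition inner (f g : vec3 R -> R) : R := lumped (fun x => f x * g x).

Definition innerv (f g : vec3 R -> vec3 R) : R :=
  lumped (fun x => dot (f x) (g x)).

Definition normh (f : vec3 R -> R) : R := Num.sqrt (inner f f).

End Surface.

Section Anisotropy.
Context (R : realType) (L : nat) (G : 'I_L -> vec3 R -> 'M[R]_3).

Definition gammal (l : 'I_L) (z q : vec3 R) : R :=
  Num.sqrt (dot q (G l z *m q)).

Definition gamma (z q : vec3 R) : R := \sum_(l < L) gammal l z q.

Definition Bmx (z q : vec3 R) : 'M[R]_3 :=
  if q == 0 then L%:R *: \sum_(l < L) G l z
  else gamma z q *: \sum_(l < L) (gammal l z q)^-1 *: G l z.

End Anisotropy.

Definition sym_posdef (R : realType) (A : 'M[R]_3) : Prop :=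
  A^T = A /\ forall q : vec3 R, q != 0 -> 0 < dot q (A *m q).

Definition Psi (R : realType) (s : R) : R := 4^-1 * (1 - s ^+ 2) ^+ 2.
Definition phip (R : realType) (s : R) : R := s ^+ 3.
Definition phim (R : realType) (s : R) : R := - s.

Definition cPsi (R : realType) : R :=
  \int[lebesgue_measure]_(s in `[(-1 : R), 1]) Num.sqrt (2 * Psi s).

Section Energies.
Context (R : realType) (M : mesh R) (L : nat) (G : 'I_L -> vec3 R -> 'M[R]_3).
Context (eps alpha a lambda theta wD : R).

Definition Eh (W Phi : vec3 R -> R) : R :=
  theta / 2 * normh M (fun x => W x - wD) ^+ 2
  + lambda * alpha / a * (cPsi R)^-1
    * (2^-1 * eps * normh M (fun x => gamma G x (sgrad M Phi x)) ^+ 2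
       + eps^-1 * inner M (fun x => Psi (Phi x)) (fun=> 1)).

Definition Fh (W Phi : vec3 R -> R) : R :=
  Eh W Phi - lambda * wD * inner M (fun=> 2^-1) (fun x => 1 + Phi x).

End Energies.

Section Scheme.
Context (R : realType) (M : mesh R) (D : {set {set nodes M}}).
Context (L : nat) (G : 'I_L -> vec3 R -> 'M[R]_3).
Context (mu : vec3 R -> vec3 R -> R).
Context (eps alpha a lambda K theta rho wD tau : R).
Context (Phi0 W0 : vec3 R -> R).

(* [(Phi, W)] solves the time step of length [tau] from [(Phi0, W0)].  The
   value of [W0] is irrelevant for [theta = 0]. *)
Definition scheme_step (Phi W : vec3 R -> R) : Prop :=
  [/\ Sh M Phi,
      Sh_bc D wD W,
      forall chi, Sh_bc D 0 chi ->
        theta * inner M (fun x => (W x - W0 x) / tau) chi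
        + 2^-1 * lambda * inner M (fun x => (Phi x - Phi0 x) / tau) chi
        + innerv M (fun x => K *: sgrad M W x) (sgrad M chi) = 0
    & forall chi, Sh M chi ->
        eps * (rho / alpha)
          * inner M (fun x => mu x (sgrad M Phi0 x)
                              * ((Phi x - Phi0 x) / tau)) chi
        + eps * innerv M (fun x => Bmx G x (sgrad M Phi0 x) *m sgrad M Phi x)
                         (sgrad M chi)
        + eps^-1 * inner M (fun x => phip (Phi x)) chi
        = inner M (fun x => 2^-1 * cPsi R * (a / alpha) * W x
                            - eps^-1 * phim (Phi0 x)) chi].

End Scheme.

(* Main.v *)
(** A function of [S^h] is determined by its nodal values: its surface gradient
is constant on each triangle and linear in them, so the scheme is a finite system
for two nodal vectors [u] (for [Phi]) and [w] (for [W - w_D]),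
[a(w,x) + <m u, x> = f(x)] for [x] vanishing on the Dirichlet nodes and
[b(u,x) + <k u^3, x> - <m w, x> = g(x)] for all [x], with [a], [b] symmetric
positive semidefinite and [m], [k] diagonal positive.

Existence is by minimisation without constraint: parametrise by [z], which stands
for [w] off the Dirichlet nodes and for [u] on them, so that the first equation
defines [u] elsewhere, and minimise
[b(u,u)/2 + sum k u^4/4 - g(u) + a(z,z)/2].  This is coercive in [u], hence in [z]
modulo the kernel of [a]; at a minimiser the residual of the second equation,
divided by [m], is the required [w] (it differs from [z] by a kernel element).

Uniqueness tests the two equations with the differences of [W] and of [Phi].
Stability tests them with [W - w_D] and [Phi - Phi0], using
[B(q) p . (p - q) >= (gamma(p)^2 - gamma(q)^2) / 2] and the convex-concave
splitting of [Psi]. *)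
Require Import Defs.
From HB Require Import structures.
From mathcomp Require Import all_boot all_order all_algebra.
From mathcomp Require Import all_classical all_reals all_analysis.
From mathcomp Require Import ring lra.

Set Implicit Arguments.
Unset Strict Implicit.
Unset Printing Implicit Defensive.

Import Order.TTheory GRing.Theory Num.Theory.
Import numFieldNormedType.Exports.
Local Open Scope classical_set_scope.
Local Open Scope ring_scope.

(** * A coupled quartic minimisation problem *)

(** First-order optimality without derivatives: for small [t] of sign opposite to [a], the linear
    term outweighs the rest. *)
Lemma linear_term_eq0 (R : realFieldType) (a b c d : R) :
  (forall t, 0 <= t * a + t ^+ 2 * (b + t * c + t ^+ 2 * d)) -> a = 0.
Proof.
move=> h; apply/eqP/negPn/negP => a0.
pose C := `|b| + `|c| + `|d|; pose s := C + `|a| + 1.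
have C0 : 0 <= C by rewrite !addr_ge0.
have s0 : 0 < s by rewrite ltr_wpDl // addr_ge0.
(* As [s] exceeds [|a|] and [C], [|t| <= 1] bounds the bracket by [C], and
   [t a + t^2 C = - (a/s)^2 (s - C)] is negative. *)
pose t := - a / s.
have t1 : `|t| <= 1.
  rewrite normrM normfV normrN (gtr0_norm s0) ler_pdivrMr // mul1r /s.
  by rewrite -addrA [C + _]addrC -!addrA lerDl addr_ge0.
have h1 : b + t * c + t ^+ 2 * d <= C.
  rewrite /C !lerD ?ler_norm //; apply: le_trans (ler_norm _) _;
    by rewrite normrM ?normrX ler_piMl // exprn_ile1.
have /le_trans : 0 <= t * a + t ^+ 2 * (b + t * c + t ^+ 2 * d) by exact: h.
move=> /(_ (t * a + t ^+ 2 * C)); rewrite lerD2l ler_wpM2l ?sqr_ge0 // => /(_ isT).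
have -> : t * a + t ^+ 2 * C = - (a ^+ 2 / s ^+ 2) * (s - C).
  by rewrite /t; field; rewrite gt_eqF.
rewrite leNgt => /negP; apply.
have sC : 0 < s - C by rewrite /s; have := normr_ge0 a; lra.
have a2 : 0 < a ^+ 2 by rewrite exprn_even_gt0.
by rewrite mulNr oppr_lt0 mulr_gt0 // divr_gt0 // exprn_gt0.
Qed.

Lemma cvg_bigsum (R : numFieldType) (T I : Type) (F : set_system T)
  {FF : Filter F} (r : seq I) (f : I -> T -> R) (l : I -> R) :
  (forall i, f i x @[x --> F] --> l i) ->
  (\sum_(i <- r) f i x) @[x --> F] --> \sum_(i <- r) l i.
Proof.
move=> fl; elim: r => [|i r ih].
  under eq_fun do rewrite big_nil.
  by rewrite big_nil; exact: cvg_cst.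
under eq_fun do rewrite big_cons.
by rewrite big_cons; apply: cvgD.
Qed.

Section RealContinuity.
Context (R : realType) (T : topologicalType).
Implicit Types f g : T -> R.

Lemma continuous_cstf (c : R) : continuous (fun _ : T => c).
Proof. by move=> x; exact: cvg_cst. Qed.

Lemma continuous_addf f g :
  continuous f -> continuous g -> continuous (fun x => f x + g x).
Proof. by move=> cf cg x; apply: cvgD; [exact: cf | exact: cg]. Qed.

Lemma continuous_subf f g :
  continuous f -> continuous g -> continuous (fun x => f x - g x).
Proof. by move=> cf cg x; apply: cvgB; [exact: cf | exact: cg]. Qed.

Lemma continuous_mulf f g :
  continuous f -> continuous g -> continuous (fun x => f x * g x).
Proof. by move=> cf cg x; apply: cvgM; [exact: cf | exact: cg]. Qed.

Lemma continuous_sumf (I : Type) (r : seq I) (F : I -> T -> R) :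
  (forall i, continuous (F i)) -> continuous (fun x => \sum_(i <- r) F i x).
Proof. by move=> cF x; apply: cvg_bigsum => i; exact: cF. Qed.

End RealContinuity.

Definition mxform (R : realType) n (A : 'M[R]_n) (x y : 'rV[R]_n) : R :=
  (x *m A *m y^T) 0 0.

Section MatrixForms.
Context (R : realType) (n : nat).
Implicit Types (A : 'M[R]_n) (x y z : 'rV[R]_n).

Lemma mxformE A x y : mxform A x y = \sum_j (x *m A) 0 j * y 0 j.
Proof. by rewrite /mxform mxE; apply: eq_bigr => j _; congr (_ * _); rewrite mxE. Qed.

Lemma mxformC A x y : A^T = A -> mxform A x y = mxform A y x.
Proof.
move=> As; rewrite /mxform; suff -> : y *m A *m x^T = (x *m A *m y^T)^T by rewrite [RHS]mxE.
by rewrite !trmx_mul trmxK As mulmxA.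
Qed.

Lemma mxform_line A x y t : A^T = A ->
  mxform A (x + t *: y) (x + t *: y)
  = mxform A x x + 2 * t * mxform A x y + t ^+ 2 * mxform A y y.
Proof.
move=> As.
have -> : mxform A (x + t *: y) (x + t *: y) =
    mxform A x x + t * mxform A x y + t * mxform A y x + t ^+ 2 * mxform A y y.
  rewrite /mxform linearD linearZ /= mulmxDl -scalemxAl !(mulmxDl, mulmxDr).
  by rewrite -!scalemxAl -!scalemxAr !mxE; ring.
by rewrite (mxformC y x As); ring.
Qed.

End MatrixForms.

(** The right side minus the left is [(k t^2 / 2 - 1)^2 / k + (t - g)^2 / 2]. This is the source of
    coercivity. *)
Lemma quartic_mono (R : realFieldType) (k t g : R) : 0 < k ->
  2^-1 * t ^+ 2 - 2^-1 * g ^+ 2 - k^-1 <= k / 4 * t ^+ 4 - g * t.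
Proof.
move=> k0.
have : 0 <= (2^-1 * k * t ^+ 2 - 1) ^+ 2 / k + 2^-1 * (t - g) ^+ 2.
  apply: addr_ge0; first by rewrite divr_ge0 ?sqr_ge0 ?ltW.
  by rewrite mulr_ge0 ?sqr_ge0 // invr_ge0.
suff -> : (2^-1 * k * t ^+ 2 - 1) ^+ 2 / k + 2^-1 * (t - g) ^+ 2 =
  k / 4 * t ^+ 4 - g * t - (2^-1 * t ^+ 2 - 2^-1 * g ^+ 2 - k^-1) by lra.
by field; rewrite gt_eqF.
Qed.

(** Weierstrass on a box. Only some point of equal energy has to lie in the box, so energies
    invariant under unbounded translations are covered. *)
Lemma continuous_coercive_min (R : realType) n (E : 'rV[R]_n -> R)
    (C : R) : continuous E ->
  (forall z, E z <= E 0 ->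
     exists2 z' : 'rV[R]_n, E z' = E z & forall j, `|z' 0 j| <= C) ->
  exists z, forall y, E z <= E y.
Proof.
move=> cE coer.
pose Q := [set v : 'rV[R]_n | forall i, `[(- C), C]%classic (v ord0 i)].
have memQ (v : 'rV[R]_n) : (forall j, `|v 0 j| <= C) -> Q v.
  by move=> vC i /=; rewrite in_itv /= -ler_norml.
have [z0 Ez0 z0C] := coer 0 (lexx _).
have [||z zQ zmin] := @EVT_min_rV R n E Q _ (rV_compact (fun=> @segment_compact _ _ _)).
- by exists z0; exact: memQ.
- exact: continuous_subspaceT.
exists z => y; case: (leP (E y) (E 0)) => [yE|/ltW yE].
  by have [y' <- y'C] := coer y yE; apply: zmin; rewrite inE; exact: memQ.
by apply: le_trans yE; rewrite -Ez0; apply: zmin; rewrite inE; exact: memQ.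
Qed.

(** * Existence for the coupled system in coordinates *)

Section QuarticSaddle.
Context (R : realType) (n : nat) (D : pred 'I_n) (A B : 'M[R]_n).
Context (m k f g : 'I_n -> R).
Hypothesis (A_sym : A^T = A) (A_ge0 : forall x, 0 <= mxform A x x).
Hypothesis (B_sym : B^T = B) (B_ge0 : forall x, 0 <= mxform B x x).
Hypothesis (m_gt0 : forall j, 0 < m j) (k_gt0 : forall j, 0 < k j).

(** Clearing the rows and columns of [D] builds the vanishing condition on [D] into the form, so [z]
    may range over all vectors and its coordinates in [D] are free for another use. *)
Let A0 : 'M[R]_n := \matrix_(i, j) (if D i || D j then 0 else A i j).

Let A0_sym : A0^T = A0.
Proof. by apply/matrixP => i j; rewrite !mxE orbC -[in LHS]A_sym mxE. Qed.

Let off (z : 'rV[R]_n) : 'rV[R]_n := \row_j (if D j then 0 else z 0 j).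

Let off_mul z j : (z *m A0) 0 j = if D j then 0 else (off z *m A) 0 j.
Proof.
rewrite mxE; case: ifP => Dj.
  by rewrite big1 // => i _; rewrite mxE Dj orbT mulr0.
rewrite mxE; apply: eq_bigr => i _; rewrite !mxE Dj orbF.
by case: (D i); rewrite ?mulr0 ?mul0r.
Qed.

Let A0_ge0 z : 0 <= mxform A0 z z.
Proof.
suff -> : mxform A0 z z = mxform A (off z) (off z) by [].
rewrite !mxformE; apply: eq_bigr => j _; rewrite off_mul [off z 0 j]mxE.
by case: ifP => _; rewrite ?mulr0 ?mul0r.
Qed.

(* The unknown [z] stands for the second component off [D] and for the first
   one on [D]; the linear equation off [D] then determines the rest of the
   first component. *)
Let u (z : 'rV[R]_n) : 'rV[R]_n :=
  \row_j (if D j then z 0 j else (f j - (z *m A0) 0 j) / m j).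

(** The linear part of the affine map [u], hence its derivative. *)
Let du (y : 'rV[R]_n) : 'rV[R]_n :=
  \row_j (if D j then y 0 j else - (y *m A0) 0 j / m j).

Let uE z j :
  u z 0 j = if D j then z 0 j else (f j - (z *m A0) 0 j) / m j.
Proof. by rewrite mxE. Qed.

Let duE y j : du y 0 j = if D j then y 0 j else - (y *m A0) 0 j / m j.
Proof. by rewrite mxE. Qed.

Let mxDZ (x y : 'rV[R]_n) t j : (x + t *: y) 0 j = x 0 j + t * y 0 j.
Proof. by rewrite 2!mxE. Qed.

Let u_line z y t : u (z + t *: y) = u z + t *: du y.
Proof.
apply/rowP => j; rewrite uE !mxDZ uE duE; case: ifP => // _.
rewrite mulmxDl -scalemxAl mxDZ; field; exact: lt0r_neq0.
Qed.

Let E (z : 'rV[R]_n) : R := 2^-1 * mxform B (u z) (u z)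
  + \sum_j (k j / 4 * u z 0 j ^+ 4 - g j * u z 0 j) + 2^-1 * mxform A0 z z.

Let E_continuous : continuous E.
Proof.
have coordM (C : 'M[R]_n) (h : 'rV[R]_n -> 'rV[R]_n) j :
    (forall i, continuous (fun z => h z 0 i)) ->
    continuous (fun z => (h z *m C) 0 j).
  move=> ch; under eq_fun do rewrite mxE.
  apply: continuous_sumf => i.
  by apply: continuous_mulf; [exact: ch | exact: continuous_cstf].
have cform (C : 'M[R]_n) (h : 'rV[R]_n -> 'rV[R]_n) :
    (forall i, continuous (fun z => h z 0 i)) ->
    continuous (fun z => mxform C (h z) (h z)).
  move=> ch; under eq_fun do rewrite mxformE.
  apply: continuous_sumf => i.
  by apply: continuous_mulf; [exact: coordM | exact: ch].
have cid i : continuous (fun z : 'rV[R]_n => z 0 i) by exact: coord_continuous.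
have cu i : continuous (fun z => u z 0 i).
  under eq_fun do rewrite uE.
  case: (D i); first exact: cid.
  apply: continuous_mulf; last exact: continuous_cstf.
  by apply: continuous_subf; [exact: continuous_cstf | exact: (coordM A0 id)].
apply: continuous_addf; first apply: continuous_addf.
- by apply: continuous_mulf; [exact: continuous_cstf | exact: cform].
- apply: continuous_sumf => j; apply: continuous_subf.
    apply: continuous_mulf; first exact: continuous_cstf.
    under eq_fun do rewrite !exprS.
    by do ![apply: continuous_mulf => //]; exact: continuous_cstf.
  by apply: continuous_mulf => //; exact: continuous_cstf.
- by apply: continuous_mulf; [exact: continuous_cstf | exact: (cform A0 id)].
Qed.

(* [E] only controls [z] modulo the kernel of [A0]: the bounded representative
   is obtained through the pseudo-inverse of [A0]. *)
Let E_coercive : exists C, forall z, E z <= E 0 ->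
  exists2 z' : 'rV[R]_n, E z' = E z & forall j, `|z' 0 j| <= C.
Proof.
(* Summing [quartic_mono] over the indices bounds the sum of the [u_j^2] by [c1] wherever
   [E z <= E 0]. *)
pose c1 := 2 * (E 0 + \sum_j (2^-1 * g j ^+ 2 + (k j)^-1)).
(* From [t^2 <= c1] follows [t <= c1 + 1], which avoids a square root. *)
pose c2 := c1 + 1.
have uC z : E z <= E 0 -> forall j, `|u z 0 j| <= c2.
  move=> zE j.
  have h : \sum_j 2^-1 * u z 0 j ^+ 2 <= 2^-1 * c1.
    rewrite /c1 mulKf ?pnatr_eq0 // -lerBlDr -sumrB; apply: le_trans zE.
    rewrite /E [_ + \sum_j _]addrC -addrA ler_wpDr //.
      by rewrite addr_ge0 // mulr_ge0 // invr_ge0.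
    by apply: ler_sum => i _; have := @quartic_mono R (k i) (u z 0 i) (g i) (k_gt0 i); lra.
  have : u z 0 j ^+ 2 <= c1.
    suff : 2^-1 * u z 0 j ^+ 2 <= \sum_j 2^-1 * u z 0 j ^+ 2 by move=> ?; lra.
    rewrite (bigD1 j) //= lerDl sumr_ge0 // => i _.
    by rewrite mulr_ge0 ?sqr_ge0 // invr_ge0.
  rewrite -real_normK ?num_real // => hu; rewrite /c2.
  have := normr_ge0 (u z 0 j); set t := `|_| in hu *; nra.
(* Off [D] the definition of [u] reads [z A0 = f - m u], so the bound on [u] bounds the image of [z]
   under [A0]. *)
pose c3 := \sum_j (`|f j| + m j * c2).
pose c4 := \sum_i \sum_j c3 * `|pinvmx A0 i j|.
exists (c2 + c4) => z zE; have {uC} uC := uC z zE.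
have c2_ge0 (j : 'I_n) : 0 <= c2 by exact: le_trans (uC j).
have Az j : `|(z *m A0) 0 j| <= c3.
  have : `|(z *m A0) 0 j| <= `|f j| + m j * c2.
    rewrite off_mul; case: ifP => Dj.
      by rewrite normr0 addr_ge0 // mulr_ge0 ?(ltW (m_gt0 j)) ?(c2_ge0 j).
    have := uC j; rewrite uE Dj off_mul Dj; set s := (_ *m _) 0 j => hs.
    have -> : s = f j - m j * ((f j - s) / m j) by field; exact: lt0r_neq0.
    apply: le_trans (ler_normB _ _) _; rewrite lerD2l normrM gtr0_norm //.
    by rewrite ler_pM2l.
  move=> /le_trans; apply; rewrite /c3 (bigD1 j) //= lerDl sumr_ge0 // => i _.
  by rewrite addr_ge0 // mulr_ge0 ?(ltW (m_gt0 i)) ?(c2_ge0 j).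
(* The pseudo-inverse picks a preimage of [z A0] that is bounded in terms of it. *)
pose y := z *m A0 *m pinvmx A0.
have yA : y *m A0 = z *m A0 by rewrite mulmxKpV // submxMl.
(* The coordinates in [D] are kept: [A0] ignores them, but [u] copies them, and this also bounds
   them by [c2]. *)
pose z' : 'rV[R]_n := \row_j if D j then z 0 j else y 0 j.
have z'A : z' *m A0 = z *m A0.
  rewrite -yA; apply/rowP => j; rewrite !off_mul; case: ifP => // _.
  by congr ((_ *m A) _ _); apply/rowP => i; rewrite !mxE; case: (D i).
exists z'.
  rewrite /E; have -> : u z' = u z.
    by apply/rowP => j; rewrite !uE z'A mxE; case: (D j).
  (* Equal images suffice for equal quadratic terms, by symmetry: [A0(z',z') = A0(z,z') = A0(z',z) =
     A0(z,z)]. *)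
  congr (_ + 2^-1 * _); rewrite [LHS]/mxform z'A -/(mxform A0 z z').
  by rewrite mxformC // /mxform z'A.
move=> j; rewrite mxE; case: ifP => Dj.
  apply: ler_wpDr; last by have := uC j; rewrite uE Dj.
  apply: sumr_ge0 => i _; apply: sumr_ge0 => i' _.
  by rewrite mulr_ge0 //; apply: le_trans (Az j).
apply: ler_wpDl; first exact: c2_ge0.
have c3_ge0 : 0 <= c3 by apply: le_trans (Az j).
rewrite /y mxE; apply: le_trans (ler_norm_sum _ _ _) _.
apply: ler_sum => i _; rewrite (bigD1 j) //= ler_wpDr //.
  by apply: sumr_ge0 => i' _; rewrite mulr_ge0.
by rewrite normrM ler_wpM2r.
Qed.

(** With [r] the residual of the second equation without its [w] term, stationarity along [y] reads
    [r . du y + A0(z, y) = 0]. Directions in [D] make [r] vanish there; the others show that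
    [w = r / m] and [z] have the same image under [A0]. *)
Lemma quartic_saddle : exists x w : 'rV[R]_n,
  [/\ forall j, D j -> w 0 j = 0,
      forall j, ~~ D j -> (w *m A) 0 j + m j * x 0 j = f j
    & forall j, (x *m B) 0 j + k j * x 0 j ^+ 3 - m j * w 0 j = g j].
Proof.
have [C coer] := E_coercive.
have [z zmin] := continuous_coercive_min E_continuous coer.
pose r j := (u z *m B) 0 j + k j * u z 0 j ^+ 3 - g j.
have stat y : \sum_j (r j * du y 0 j) + mxform A0 z y = 0.
  (* The witnesses are the coefficients of [t^2], [t^3] and [t^4] in [E (z + t y) - E z]. *)
  apply: (@linear_term_eq0 _ _ (2^-1 * mxform B (du y) (du y)
      + \sum_j (3 / 2 * k j * u z 0 j ^+ 2 * du y 0 j ^+ 2)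
      + 2^-1 * mxform A0 y y)
    (\sum_j (k j * u z 0 j * du y 0 j ^+ 3)) (\sum_j (k j / 4 * du y 0 j ^+ 4))).
  move=> t; have := zmin (z + t *: y); rewrite -subr_ge0.
  suff -> : E (z + t *: y) - E z = t * (\sum_j (r j * du y 0 j) + mxform A0 z y)
     + t ^+ 2 * (2^-1 * mxform B (du y) (du y)
      + \sum_j (3 / 2 * k j * u z 0 j ^+ 2 * du y 0 j ^+ 2)
      + 2^-1 * mxform A0 y y + t * (\sum_j (k j * u z 0 j * du y 0 j ^+ 3))
      + t ^+ 2 * (\sum_j (k j / 4 * du y 0 j ^+ 4))) by [].
  rewrite /E u_line !mxform_line //.
  have -> : \sum_j (k j / 4 * (u z + t *: du y) 0 j ^+ 4
                    - g j * (u z + t *: du y) 0 j) =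
     \sum_j (k j / 4 * u z 0 j ^+ 4 - g j * u z 0 j)
     + t * (\sum_j (k j * u z 0 j ^+ 3 - g j) * du y 0 j)
     + t ^+ 2 * (\sum_j (3 / 2 * k j * u z 0 j ^+ 2 * du y 0 j ^+ 2))
     + t ^+ 3 * (\sum_j (k j * u z 0 j * du y 0 j ^+ 3))
     + t ^+ 4 * (\sum_j (k j / 4 * du y 0 j ^+ 4)).
    rewrite !mulr_sumr -!big_split /=; apply: eq_bigr => j _.
    by rewrite mxDZ; field.
  have -> : \sum_j r j * du y 0 j = mxform B (u z) (du y)
       + \sum_j (k j * u z 0 j ^+ 3 - g j) * du y 0 j.
    rewrite mxformE -big_split /=; apply: eq_bigr => j _; rewrite /r; ring.
  by field.
pose w : 'rV[R]_n := \row_j (r j / m j).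
have deltaA j i : (delta_mx 0 j *m A0) 0 i = A0 j i.
  rewrite mxE (bigD1 j) //= big1 ?addr0 => [|l lj].
    by rewrite mxE !eqxx mul1r.
  by rewrite mxE (negPf lj) andbF mul0r.
(* For [j] in [D], row [j] of [A0] is zero, so [du] fixes the unit vector of [j] and stationarity
   reduces to [r j = 0]. *)
have rD j : D j -> r j = 0.
  move=> Dj; have dA0 i : (delta_mx 0 j *m A0) 0 i = 0.
    by rewrite deltaA mxE Dj.
  have := stat (delta_mx 0 j).
  rewrite mxformC // mxformE (bigD1 j) //= duE Dj mxE !eqxx mulr1.
  rewrite big1 => [|i ij].
    by rewrite big1 ?addr0 // => i _; rewrite dA0 mul0r.
  by rewrite duE dA0 mxE (negPf ij) andbF oppr0 mul0r if_same mulr0.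
have w0 j : D j -> w 0 j = 0 by move=> Dj; rewrite mxE rD // mul0r.
exists (u z), w; split=> // j.
  move=> Dj.
  have offw : off w = w.
    by apply/rowP => i; rewrite mxE; case: ifP => // /w0.
  have -> : (w *m A) 0 j = (w *m A0) 0 j by rewrite off_mul (negPf Dj) offw.
  (* The first equation sees [w] only through its image under [A0]; [w] and [z] themselves may
     differ. *)
  suff -> : (w *m A0) 0 j = (z *m A0) 0 j.
    by rewrite uE (negPf Dj); field; exact: lt0r_neq0.
  have := stat (delta_mx 0 j); have -> : mxform A0 z (delta_mx 0 j) = (z *m A0) 0 j.
    rewrite mxformE (bigD1 j) //= [delta_mx _ _ _ _]mxE !eqxx mulr1.
    by rewrite big1 ?addr0 // => i ij; rewrite [delta_mx _ _ _ _]mxE (negPf ij) andbF mulr0.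
  move=> /eqP; rewrite addrC addr_eq0 => /eqP ->; rewrite mxE -sumrN.
  apply: eq_bigr => i _; rewrite [w 0 i]mxE duE.
  case: ifP => Di; first by rewrite rD // !mul0r oppr0.
  rewrite deltaA -{1}A0_sym [_^T _ _]mxE.
  by field; exact: lt0r_neq0.
by rewrite [w 0 j]mxE /r; field; exact: lt0r_neq0.
Qed.

End QuarticSaddle.

(** * From coordinates to functions on a finite type and the weak form *)

Section BilinearForms.
Context (R : realType) (J : finType).
Implicit Types (x y z : J -> R) (l : (J -> R) -> R).

Definition linear_fun l :=
  forall t x y, l (fun j => t * x j + y j) = t * l x + l y.

Definition psd_form (a : (J -> R) -> (J -> R) -> R) :=
  [/\ forall z, linear_fun (a^~ z), forall x y, a x y = a y x
    & forall x, 0 <= a x x].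

Definition unit_fun (j : J) : J -> R := fun i => (i == j)%:R.

Lemma linear_fun_expand l x : linear_fun l -> l x = \sum_j x j * l (unit_fun j).
Proof.
move=> lin; have l0 : l (fun=> 0) = 0.
  have := lin 1 (fun=> 0) (fun=> 0); under eq_fun do rewrite mulr0 addr0.
  by move=> ?; lra.
have expand r : l (fun i => \sum_(j <- r) x j * unit_fun j i)
    = \sum_(j <- r) x j * l (unit_fun j).
  elim: r => [|j r ih]; first by rewrite big_nil -l0; congr l; apply/funext => i;
    rewrite big_nil.
  rewrite big_cons -ih -lin; congr l; apply/funext => i.
  by rewrite big_cons.
rewrite -expand; congr l; apply/funext => i.
rewrite (bigD1 i) //= big1 ?addr0 => [|j ji]; rewrite /unit_fun ?eqxx ?mulr1 //.
by rewrite eq_sym (negPf ji) mulr0.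
Qed.

(** The equations of [quartic_saddle], indexed through [enum_rank], are multiplied by [x j] and
    summed; in the first one the indices in [D] drop out because [x] vanishes there. *)
Lemma saddle_solution (D : pred J) (a b : (J -> R) -> (J -> R) -> R)
    (m k f g : J -> R) : psd_form a -> psd_form b ->
  (forall j, 0 < m j) -> (forall j, 0 < k j) ->
  exists u w : J -> R,
  [/\ forall j, D j -> w j = 0,
      forall x, (forall j, D j -> x j = 0) ->
        a w x + \sum_j m j * u j * x j = \sum_j f j * x j
    & forall x, b u x + \sum_j k j * u j ^+ 3 * x j - \sum_j m j * w j * x j
                = \sum_j g j * x j].
Proof.
move=> [a_lin a_sym a_ge0] [b_lin b_sym b_ge0] m0 k0.
pose mx (c : (J -> R) -> (J -> R) -> R) : 'M[R]_#|J| :=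
  \matrix_(i, j) c (unit_fun (enum_val i)) (unit_fun (enum_val j)).
pose fn (v : 'rV[R]_#|J|) : J -> R := fun j => v 0 (enum_rank j).
have mx_sym c : (forall x y, c x y = c y x) -> (mx c)^T = mx c.
  by move=> cs; apply/matrixP => i j; rewrite !mxE.
have mulE c v i : (forall z, linear_fun (c^~ z)) ->
    (v *m mx c) 0 i = c (fn v) (unit_fun (enum_val i)).
  move=> /(_ (unit_fun (enum_val i)))/(linear_fun_expand (fn v)) ->.
  rewrite mxE (reindex _ (onW_bij _ (@enum_rank_bij J))).
  by apply: eq_bigr => j _; rewrite mxE enum_rankK.
have formE c v x : (forall z, linear_fun (c^~ z)) -> (forall x y, c x y = c y x) ->
    \sum_i (v *m mx c) 0 i * x (enum_val i) = c (fn v) x.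
  move=> cl cs; rewrite cs (linear_fun_expand x (cl _)).
  rewrite (reindex _ (onW_bij _ (@enum_rank_bij J))).
  by apply: eq_bigr => j _; rewrite mulE // enum_rankK mulrC cs.
have mx_ge0 c v : (forall z, linear_fun (c^~ z)) -> (forall x y, c x y = c y x) ->
    (forall x, 0 <= c x x) -> 0 <= mxform (mx c) v v.
  move=> cl cs c0; rewrite mxformE (_ : \sum_j _ = c (fn v) (fn v)) //.
  by rewrite -formE //; apply: eq_bigr => j _; rewrite /fn enum_valK.
have [v [w [w0 eqA eqB]]] := @quartic_saddle R #|J| (D \o enum_val) (mx a) (mx b)
  (m \o enum_val) (k \o enum_val) (f \o enum_val) (g \o enum_val)
  (mx_sym _ a_sym) (fun v => mx_ge0 _ v a_lin a_sym a_ge0)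
  (mx_sym _ b_sym) (fun v => mx_ge0 _ v b_lin b_sym b_ge0)
  (fun j => m0 _) (fun j => k0 _).
exists (fn v), (fn w); split=> [j Dj|x x0|x].
- by apply: w0; rewrite /= enum_rankK.
- rewrite -formE // (reindex _ (onW_bij _ (@enum_rank_bij J))) -big_split /=.
  apply: eq_bigr => j _; rewrite enum_rankK; case Dj : (D j).
    by rewrite x0 ?Dj // !mulr0 addr0.
  have := eqA (enum_rank j); rewrite /= enum_rankK Dj => /(_ isT) <-.
  by rewrite /fn mulrDl.
- rewrite -formE // (reindex _ (onW_bij _ (@enum_rank_bij J))) -big_split /= -sumrB.
  apply: eq_bigr => j _; rewrite enum_rankK.
  by have := eqB (enum_rank j); rewrite /= enum_rankK => <-; rewrite /fn; ring.
Qed.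

End BilinearForms.

(** * Geometry of the triangles *)

Lemma sum3E (V : nmodType) (F : 'I_3 -> V) :
  \sum_(k < 3) F k = F 0 + F 1 + F 2%:R.
Proof.
rewrite !big_ord_recl big_ord0 addr0 addrA.
by do ![congr (_ + _)]; congr F; apply: val_inj.
Qed.

Lemma ord3_cases (k : 'I_3) : [\/ k = 0, k = 1 | k = 2%:R].
Proof.
case: k => [[|[|[|//]]] lt_k3]; [apply: Or31|apply: Or32|apply: Or33];
  exact: val_inj.
Qed.

Section Dot.
Context (R : realType).
Implicit Types (u v w : vec3 R) (t : R).

Lemma dotE u v : dot u v = u 0 0 * v 0 0 + u 1 0 * v 1 0 + u 2%:R 0 * v 2%:R 0.
Proof. exact: sum3E. Qed.

Lemma dotC u v : dot u v = dot v u.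
Proof. by rewrite !dotE; ring. Qed.

Lemma dotDl u v w : dot (u + v) w = dot u w + dot v w.
Proof. by rewrite !dotE !mxE; ring. Qed.

Lemma dotZl t u v : dot (t *: u) v = t * dot u v.
Proof. by rewrite !dotE !mxE; ring. Qed.

Lemma dotBl u v w : dot (u - v) w = dot u w - dot v w.
Proof. by rewrite !dotE !mxE; ring. Qed.

Lemma dotDr u v w : dot u (v + w) = dot u v + dot u w.
Proof. by rewrite !dotE !mxE; ring. Qed.

Lemma dotZr t u v : dot u (t *: v) = t * dot u v.
Proof. by rewrite !dotE !mxE; ring. Qed.

Lemma dotBr u v w : dot u (v - w) = dot u v - dot u w.
Proof. by rewrite !dotE !mxE; ring. Qed.

Lemma dotNl u v : dot (- u) v = - dot u v.
Proof. by rewrite !dotE !mxE; ring. Qed.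

Lemma dotNr u v : dot u (- v) = - dot u v.
Proof. by rewrite !dotE !mxE; ring. Qed.

Lemma dot0l u : dot 0 u = 0.
Proof. by rewrite !dotE !mxE; ring. Qed.

Lemma dot_ge0 u : 0 <= dot u u.
Proof. by rewrite dotE -!expr2 !addr_ge0 ?sqr_ge0. Qed.

Lemma enorm_sqr u : enorm u ^+ 2 = dot u u.
Proof. by rewrite sqr_sqrtr ?dot_ge0. Qed.

End Dot.

Definition dotE_lin := (dotDl, dotDr, dotNl, dotNr, dotZl, dotZr).

Section Triangle.
Context (R : realType) (M : mesh R) (s : triangles M).

Definition edge1 : vec3 R := corner s 1 - corner s 0.
Definition edge2 : vec3 R := corner s 2%:R - corner s 0.
Definition edge2_perp : vec3 R := edge2 - dot edge2 (frame1 s) *: frame1 s.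

(** This Gram determinant is four times the squared area of the triangle. *)
Lemma gram_gt0 :
  0 < dot edge1 edge1 * dot edge2 edge2 - dot edge1 edge2 ^+ 2.
Proof.
have := Defs.nondegenerate s; rewrite /triangle_area.
by rewrite pmulr_rgt0 ?invr_gt0 // sqrtr_gt0.
Qed.

Lemma edge1_gt0 : 0 < dot edge1 edge1.
Proof.
rewrite lt_neqAle dot_ge0 andbT eq_sym; apply/eqP => e0.
by have := gram_gt0; rewrite e0 mul0r sub0r oppr_gt0 ltNge sqr_ge0.
Qed.

Lemma enorm_edge1_gt0 : 0 < enorm edge1.
Proof. by rewrite sqrtr_gt0 edge1_gt0. Qed.

Lemma edge1E : edge1 = enorm edge1 *: frame1 s.
Proof.
by rewrite /frame1 -/edge1 scalerA divff ?scale1r // gt_eqF // enorm_edge1_gt0.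
Qed.

Lemma dot_frame1 : dot (frame1 s) (frame1 s) = 1.
Proof.
rewrite /frame1 -/edge1 dotZl dotZr -enorm_sqr.
by field; rewrite gt_eqF // enorm_edge1_gt0.
Qed.

(** The squared length is the Gram determinant divided by that of [edge1]. *)
Lemma enorm_edge2_perp_gt0 : 0 < enorm edge2_perp.
Proof.
have e0 := enorm_edge1_gt0; have e2 := enorm_sqr edge1; have := gram_gt0.
rewrite sqrtr_gt0 /edge2_perp /frame1 -/edge1.
move: edge1 edge2 e0 e2 => v1 v2; rewrite !dotE_lin (dotC v2 v1) => n0 <-.
move: (dot v1 v2) (dot v2 v2) (enorm v1) n0 => b c n n0 g0.
rewrite [X in _ < X](_ : _ = (n ^+ 2 * c - b ^+ 2) / n ^+ 2).
  by rewrite divr_gt0 // exprn_gt0.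
by field; rewrite gt_eqF.
Qed.

Lemma edge2E :
  edge2 = dot edge2 (frame1 s) *: frame1 s + enorm edge2_perp *: frame2 s.
Proof.
rewrite /frame2 -/edge2 -/edge2_perp [X in _ + X]scalerA divff ?scale1r; last first.
  by rewrite gt_eqF // enorm_edge2_perp_gt0.
by rewrite addrC subrK.
Qed.

Lemma dot_frame12 : dot (frame1 s) (frame2 s) = 0.
Proof.
rewrite /frame2 -/edge2 -/edge2_perp dotZr /edge2_perp dotBr dotZr dot_frame1.
by rewrite (dotC edge2) mulr1 subrr mulr0.
Qed.

Lemma dot_frame2 : dot (frame2 s) (frame2 s) = 1.
Proof.
rewrite /frame2 -/edge2 -/edge2_perp dotZl dotZr -enorm_sqr.
by field; rewrite gt_eqF // enorm_edge2_perp_gt0.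
Qed.

(** Products with both edges give a linear system whose matrix is the Gram matrix; Cramer's rule
    concludes. *)
Lemma edges_free t1 t2 : t1 *: edge1 + t2 *: edge2 = 0 -> t1 = 0 /\ t2 = 0.
Proof.
move=> e0; have := gram_gt0.
have h1 : t1 * dot edge1 edge1 + t2 * dot edge1 edge2 = 0.
  by rewrite -(dotC edge2) -!dotZl -dotDl e0 dot0l.
have h2 : t1 * dot edge1 edge2 + t2 * dot edge2 edge2 = 0.
  by rewrite -!dotZl -dotDl e0 dot0l.
set a := dot edge1 edge1 in h1 *; set b := dot edge1 edge2 in h1 h2 *.
set c := dot edge2 edge2 in h2 * => g0.
have g1 : t1 * (a * c - b ^+ 2) = 0.
  transitivity (c * (t1 * a + t2 * b) - b * (t1 * b + t2 * c)); first by ring.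
  by rewrite h1 h2; ring.
have g2 : t2 * (a * c - b ^+ 2) = 0.
  transitivity (a * (t1 * b + t2 * c) - b * (t1 * a + t2 * b)); first by ring.
  by rewrite h1 h2; ring.
by move/eqP: g1; move/eqP: g2; rewrite !mulf_eq0 !(gt_eqF g0) !orbF => /eqP -> /eqP.
Qed.

Lemma corner_comb (t : 'I_3 -> R) : \sum_k t k *: corner s k =
  (\sum_k t k) *: corner s 0 + (t 1 *: edge1 + t 2%:R *: edge2).
Proof.
by rewrite !sum3E /edge1 /edge2; apply/matrixP => i j; rewrite !mxE; ring.
Qed.

Lemma corner_comb_inj (t r : 'I_3 -> R) : \sum_k t k = \sum_k r k ->
  \sum_k t k *: corner s k = \sum_k r k *: corner s k -> t =1 r.
Proof.
move=> htr; rewrite !corner_comb htr => /addrI/eqP; rewrite -subr_eq0.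
rewrite opprD addrACA -!scalerBl => /eqP/edges_free[h1 h2].
have h0 : t 0 = r 0 by move: htr; rewrite !sum3E; lra.
by move=> k; case: (ord3_cases k) => -> //; lra.
Qed.

(** The mesh axioms state nondegeneracy rather than distinctness of the vertices: two equal ones
    would give one corner two barycentric representations. *)
Lemma vert_inj : injective (vert s).
Proof.
move=> i j vij; pose dl (l k : 'I_3) : R := (k == l)%:R.
have dlE (V : lmodType R) (F : 'I_3 -> V) l : \sum_k dl l k *: F k = F l.
  rewrite (bigD1 l) //= /dl eqxx scale1r big1 ?addr0 // => k kl.
  by rewrite (negPf kl) scale0r.
have sum1 l : \sum_k dl l k = 1.
  by rewrite -[RHS](dlE R^o (fun=> 1) l); apply: eq_bigr => k _; rewrite -[RHS]/(_ * _) mulr1.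
have := @corner_comb_inj (dl i) (dl j); rewrite !sum1 !dlE /corner vij.
by move=> /(_ erefl erefl i); rewrite /dl eqxx; case: eqP => // _ /eqP;
  rewrite oner_eq0.
Qed.

Lemma mem_verts k : vert s k \in verts s.
Proof. by apply/imsetP; exists k. Qed.

Lemma big_verts (V : nmodType) (F : nodes M -> V) :
  \sum_(j in verts s) F j = \sum_k F (vert s k).
Proof.
by rewrite /verts /verts_of big_imset /=; [apply: eq_bigl | move=> i j _ _; exact: vert_inj].
Qed.

Lemma triP x : tri s x <-> exists t : 'I_3 -> R,
  [/\ forall k, 0 < t k, \sum_k t k = 1 & x = \sum_k t k *: corner s k].
Proof.
split=> [[t [t0 t1 ->]]|[t [t0 t1 ->]]].
  exists (t \o vert s); split=> [k||].
  - exact/t0/mem_verts.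
  - by rewrite -t1 big_verts.
  - by rewrite big_verts.
(* By injectivity of [vert s] each fibre has at most one element, so the sum just transports [t] to
   the nodes. *)
pose t' j := \sum_(k | vert s k == j) t k.
have t'E k : t' (vert s k) = t k.
  by rewrite /t' (big_pred1 k) // => i; rewrite (inj_eq vert_inj).
exists t'; split=> [j /imsetP[k _ ->]||]; rewrite ?t'E //.
- by rewrite big_verts -t1; apply: eq_bigr => k _.
- by rewrite big_verts; apply: eq_bigr => k _; rewrite t'E.
Qed.

(** The weights live on all nodes, so that one [t] can serve as barycentric coordinates in several
    triangles at once; their signs are left free. *)
Definition bary (t : nodes M -> R) x :=
  \sum_k t (vert s k) = 1 /\ x = \sum_k t (vert s k) *: corner s k.

Lemma bary_inj (t r : nodes M -> R) x j :
  bary t x -> bary r x -> j \in verts s -> t j = r j.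
Proof.
move=> [t1 xt] [r1 xr] /imsetP[k _ ->].
by apply: (@corner_comb_inj (t \o vert s) (r \o vert s)); rewrite /= ?t1 ?r1 -?xt.
Qed.

Lemma tri_bary x : tri s x -> exists2 t : nodes M -> R,
  bary t x & forall j, j \in verts s -> 0 < t j.
Proof.
by move=> [t [t0 t1 ->]]; exists t => //; split; rewrite -?t1 big_verts.
Qed.

End Triangle.

(** * Consequences of conformity *)

Section Conforming.
Context (R : realType) (M : mesh R).
Implicit Types (s : triangles M) (A : {set nodes M}).

(** Weights on [A] extended by zero are barycentric coordinates in every triangle having [A] among
    its vertices. *)
Lemma hull_bary A x : hull (@node R M) A x -> exists t : nodes M -> R,
  [/\ forall j, 0 <= t j, forall j, j \notin A -> t j = 0
    & forall s, A \subset verts s -> bary s t x].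
Proof.
move=> [t [t0 t1 ->]]; exists (fun j => if j \in A then t j else 0); split.
- by move=> j; case: ifP => // /t0.
- by move=> j /negPf ->.
move=> s /fintype.subsetP As.
have restr (V : nmodType) (F : nodes M -> V) :
    \sum_(j in verts s) (if j \in A then F j else 0) = \sum_(j in A) F j.
  rewrite -big_mkcondr; apply: eq_bigl => j.
  by case jA : (j \in A); rewrite ?andbF // As.
split.
  by rewrite -[LHS](big_verts s (fun j => if j \in A then t j else 0)) restr.
rewrite -[RHS](big_verts s (fun j => (if j \in A then t j else 0) *: node j)).
by rewrite -restr; apply: eq_bigr => j _; case: ifP => // _; rewrite scale0r.
Qed.

(** Conformity of a triangle with itself. *)
Lemma closure_tri s : closure (tri s) = hull (@node R M) (verts s).
Proof. by rewrite -[LHS]setIid [LHS]conforming finset.setIid. Qed.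

Lemma closure_triI s s' x : closure (tri s) x -> closure (tri s') x ->
  exists t : nodes M -> R, [/\ forall j, j \notin verts s -> t j = 0,
    forall j, j \notin verts s' -> t j = 0, bary s t x & bary s' t x].
Proof.
move=> xs xs'; have : (closure (tri s) `&` closure (tri s')) x by [].
rewrite conforming => /hull_bary[t [_ tA tb]]; exists t; split.
- by move=> j js; apply: tA; rewrite finset.inE (negPf js).
- by move=> j js'; apply: tA; rewrite finset.inE (negPf js') andbF.
- exact/tb/subsetIl.
- exact/tb/subsetIr.
Qed.

(** A point of an open triangle has positive coordinates, whereas conformity makes those off the
    common vertices zero. So the vertex sets include each other. *)
Lemma tri_disjoint s s' x : tri s x -> tri s' x -> s = s'.
Proof.
suff sub (s1 s2 : triangles M) : tri s1 x -> tri s2 x -> verts s1 \subset verts s2.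
  by move=> xs xs'; apply: (@verts_inj _ M); apply/eqP;
    rewrite finset.eqEsubset !sub.
move=> x1 x2; have [r rb r0] := tri_bary x1.
have [t [_ tA tb _]] := closure_triI (subset_closure x1) (subset_closure x2).
apply/fintype.subsetP => j j1; apply: contraT => /tA t0.
by have := r0 j j1; rewrite (bary_inj rb tb) // t0 ltxx.
Qed.

Lemma closure_tri_bary s x : closure (tri s) x -> exists2 t : nodes M -> R,
  bary s t x & forall j, 0 <= t j.
Proof. by rewrite closure_tri => /hull_bary[t [t0 _ tb]]; exists t => //; exact: tb. Qed.

Lemma node_hull A j : j \in A -> hull (@node R M) A (node j).
Proof.
move=> jA; exists (fun i => (i == j)%:R); split=> [i _||]; first exact: ler0n.
- by rewrite (bigD1 j) //= eqxx big1 ?addr0 // => i /andP[_ /negPf ->].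
- rewrite (bigD1 j) //= eqxx scale1r big1 ?addr0 // => i /andP[_ /negPf ->].
  by rewrite scale0r.
Qed.

Lemma corner_closure s k : closure (tri s) (corner s k).
Proof. by rewrite closure_tri; apply/node_hull/mem_verts. Qed.

Lemma closure_tri_surface s x : closure (tri s) x -> surface M x.
Proof. by exists s. Qed.

End Conforming.

(** * Gradient of the affine function with given nodal values *)

Section DiscreteGradient.
Context (R : realType) (M : mesh R) (s : triangles M).
Implicit Types (u : nodes M -> R).

(** The vector in the plane of the triangle whose products with the two edges are the increments of
    [u], written in the Gram-Schmidt frame. *)
Definition dgrad u : vec3 R :=
  let d1 := (u (vert s 1) - u (vert s 0)) / enorm (edge1 s) in
  d1 *: frame1 s
  + ((u (vert s 2%:R) - u (vert s 0) - dot (edge2 s) (frame1 s) * d1)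
     / enorm (edge2_perp s)) *: frame2 s.

Lemma dgrad_linear t x y :
  dgrad (fun j => t * x j + y j) = t *: dgrad x + dgrad y.
Proof. by apply/matrixP => i j; rewrite /dgrad !mxE; ring. Qed.

Lemma dot_dgrad_edge1 u : dot (dgrad u) (edge1 s) = u (vert s 1) - u (vert s 0).
Proof.
rewrite [X in dot _ X]edge1E /dgrad; move: (dot_frame1 s) (dot_frame12 s).
move: (frame1 s) (frame2 s) (dot (edge2 s)) => f1 f2 l h11 h12.
rewrite !dotE_lin h11 (dotC f2) h12; field.
by rewrite !gt_eqF ?enorm_edge1_gt0 ?enorm_edge2_perp_gt0.
Qed.

Lemma dot_dgrad_edge2 u : dot (dgrad u) (edge2 s) = u (vert s 2%:R) - u (vert s 0).
Proof.
rewrite [X in dot _ X]edge2E /dgrad.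
move: (dot_frame1 s) (dot_frame12 s) (dot_frame2 s).
move: (frame1 s) (frame2 s) (dot (edge2 s)) => f1 f2 l h11 h12 h22.
rewrite !dotE_lin h11 (dotC f2) h12 h22; field.
by rewrite !gt_eqF ?enorm_edge1_gt0 ?enorm_edge2_perp_gt0.
Qed.

(** The increments along the edges determine [g] only up to its normal part, so it is the tangential
    projection that is identified. *)
Lemma dgradE u g : dot g (edge1 s) = u (vert s 1) - u (vert s 0) ->
  dot g (edge2 s) = u (vert s 2%:R) - u (vert s 0) ->
  dot g (frame1 s) *: frame1 s + dot g (frame2 s) *: frame2 s = dgrad u.
Proof.
move=> h1 h2; have n1 := enorm_edge1_gt0 s; have n2 := enorm_edge2_perp_gt0 s.
have g1 : dot g (frame1 s) = (u (vert s 1) - u (vert s 0)) / enorm (edge1 s).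
  by rewrite -h1 [X in dot _ X / _]edge1E dotZr; field; rewrite gt_eqF.
rewrite /dgrad -g1; congr (_ + _ *: _).
have := edge2E s; move: (frame1 s) (frame2 s) (dot (edge2 s) (frame1 s)).
by move=> f1 f2 l e2; rewrite -h2 e2 dotDr !dotZr; field; rewrite gt_eqF.
Qed.

Definition affine_interp u x := u (vert s 0) + dot (dgrad u) (x - corner s 0).

Lemma affine_interp_bary u t x : bary s t x ->
  affine_interp u x = \sum_k t (vert s k) * u (vert s k).
Proof.
move=> [t1 ->]; rewrite /affine_interp (corner_comb s (t \o vert s)) /= t1 scale1r.
rewrite [_ + _ - _]addrC addKr dotDr !dotZr dot_dgrad_edge1 dot_dgrad_edge2.
have : t (vert s 0) = 1 - t (vert s 1) - t (vert s 2%:R).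
  by rewrite -t1 sum3E; ring.
by rewrite sum3E => ->; ring.
Qed.

End DiscreteGradient.

Lemma continuous_dot (R : realType) (g : vec3 R) : continuous (dot g).
Proof.
apply: continuous_sumf => i; apply: continuous_mulf; first exact: continuous_cstf.
exact: coord_continuous.
Qed.

(** * Finite element functions: boundary values and surface gradient *)

Section Traces.
Context (R : realType) (M : mesh R).
Implicit Types (s : triangles M) (f : vec3 R -> R).

Lemma within_tri_proper s x : closure (tri s) x -> ProperFilter (within (tri s) (nbhs x)).
Proof. exact: within_nbhs_proper. Qed.

Lemma cvg_within_tri (T : topologicalType) (f : vec3 R -> T) s x :
  {within surface M, continuous f} -> closure (tri s) x ->
  f y @[y --> within (tri s) (nbhs x)] --> f x.
Proof.
move=> /subspace_continuousP cf xs.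
apply: cvg_trans (cf x (closure_tri_surface xs)); apply: cvg_app; apply: within_subset.
by move=> y ys; apply: (@closure_tri_surface _ _ s); exact: subset_closure.
Qed.

(** Both sides are limits of [f] from inside the triangle. *)
Lemma affine_on_closure s f g c x : {within surface M, continuous f} ->
  (forall y, tri s y -> f y = dot g y + c) -> closure (tri s) x -> f x = dot g x + c.
Proof.
move=> cf fE xs; have FF := within_tri_proper xs.
apply: (@cvg_unique _ (@Rhausdorff R) _ (fmap_proper_filter f FF)) => /=.
  exact: cvg_within_tri.
apply: (@cvg_trans _ ((fun y => dot g y + c) @ within (tri s) (nbhs x))).
  apply: near_eq_cvg; rewrite near_withinE; apply: filterE => y ys.
  by rewrite fE.
apply: cvg_within_filter.
apply: (@continuous_addf R _ (dot g) (fun=> c)); first exact: continuous_dot.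
exact: continuous_cstf.
Qed.

Lemma affine_on_edges s f g c : {within surface M, continuous f} ->
  (forall y, tri s y -> f y = dot g y + c) ->
  dot g (edge1 s) = f (corner s 1) - f (corner s 0) /\
  dot g (edge2 s) = f (corner s 2%:R) - f (corner s 0).
Proof.
move=> cf fE; rewrite /edge1 /edge2 !dotBr.
by rewrite !(affine_on_closure cf fE (@corner_closure _ _ s _)); split; ring.
Qed.

Lemma Sh_bary f s t x : Sh M f -> bary s t x -> closure (tri s) x ->
  f x = \sum_k t (vert s k) * f (corner s k).
Proof.
move=> [cf /(_ s)[g [c fE]]] [t1 xE] xs.
rewrite (affine_on_closure cf fE xs) xE.
move: t1; rewrite !sum3E !(affine_on_closure cf fE (@corner_closure _ _ s _)) => t1.
by rewrite !dotE_lin -[X in _ + X = _]mul1r -t1; ring.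
Qed.

Lemma Sh_eq_on_surface f h x : Sh M f -> Sh M h ->
  (forall j : nodes M, f (node j) = h (node j)) -> surface M x -> f x = h x.
Proof.
move=> Sf Sg fg [s _ xs]; have [t tb _] := closure_tri_bary xs.
rewrite (Sh_bary Sf tb xs) (Sh_bary Sg tb xs).
by apply: eq_bigr => k _; rewrite /corner fg.
Qed.

(** The open triangle is relatively open in its plane; this lets directional derivatives be computed
    inside it. *)
Lemma tri_near s x a b : tri s x ->
  \forall h \near (0 : R), tri s (h *: (a *: edge1 s + b *: edge2 s) + x).
Proof.
move=> /triP[t [t0 t1 xE]].
(* Rates of change of the barycentric coordinates in the given direction; they sum to zero. *)
pose d (k : 'I_3) : R := if k == 0 then - (a + b) else if k == 1 then a else b.
have dpos k : \forall h \near (0 : R), 0 < t k + h * d k.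
  have cd : continuous (fun h : R => t k + h * d k).
    apply: continuous_addf; first exact: continuous_cstf.
    by apply: continuous_mulf; [move=> y; exact: cvg_id | exact: continuous_cstf].
  by apply: (cvgr_gt _ (cd 0)); rewrite mul0r addr0.
near=> h; apply/triP; exists (fun k => t k + h * d k); split.
- move=> k; case: (ord3_cases k) => ->; near: h; exact: dpos.
- by rewrite -t1 !sum3E /d /=; ring.
- rewrite xE !sum3E /d /=; apply/matrixP => i j; rewrite /edge1 /edge2 !mxE; ring.
Unshelve. all: by end_near.
Qed.

Lemma derive_affine s f g c x a b : (forall y, tri s y -> f y = dot g y + c) ->
  tri s x ->
  'D_(a *: edge1 s + b *: edge2 s) f x = dot g (a *: edge1 s + b *: edge2 s).
Proof.
move=> fE xs; set v := _ + _; apply: cvg_lim; first exact: Rhausdorff.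
apply: (@cvg_trans _ ((fun=> dot g v) @ (0 : R)^')); last exact: cvg_cst.
apply: near_eq_cvg; near=> h => /=.
have h0 : h != 0 by near: h; exact: nbhs_dnbhs_neq.
rewrite fE; last by near: h; apply: cvg_within; exact: tri_near.
by rewrite fE // (dotDr g (h *: v)) (dotZr h) -[RHS]/(_ * _); field.
Unshelve. all: by end_near.
Qed.

(** The frame vectors are combinations of the edges, so the derivatives in [sgrad] are those of the
    affine formula, and [dgradE] identifies the result. *)
Lemma sgrad_dgrad s f x : Sh M f -> tri s x ->
  sgrad M f x = dgrad s (fun j : nodes M => f (node j)).
Proof.
move=> [cf fs] xs; rewrite /sgrad.
case: pickP => [s' /asboolP xs'|/(_ s)/asboolP//].
rewrite -{s' xs'}(tri_disjoint xs xs').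
have [g [c fE]] := fs s; have [h1 h2] := affine_on_edges cf fE.
rewrite -(@dgradE _ _ s _ g) //; congr (_ *: _ + _ *: _).
  rewrite (_ : frame1 s = (enorm (edge1 s))^-1 *: edge1 s + 0 *: edge2 s).
    exact: derive_affine fE xs.
  by rewrite scale0r addr0.
rewrite (_ : frame2 s = (- (enorm (edge2_perp s))^-1 * dot (edge2 s) (frame1 s)
   * (enorm (edge1 s))^-1) *: edge1 s + (enorm (edge2_perp s))^-1 *: edge2 s).
  exact: derive_affine fE xs.
rewrite /frame2 -/(edge2 s) -/(edge2_perp s); move: (enorm (edge2_perp s))^-1 => n2.
rewrite /edge2_perp [X in _ - _ *: X](_ : _ = (enorm (edge1 s))^-1 *: edge1 s) //.
by apply/matrixP => i j; rewrite !mxE; ring.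
Qed.

End Traces.

(** * The finite element function with prescribed nodal values *)

Section Interpolation.
Context (R : realType) (M : mesh R).
Implicit Types (u : nodes M -> R).

Definition interp u (x : vec3 R) : R :=
  if [pick s | `[< closure (tri s) x >]] is Some s then affine_interp s u x
  else 0.

(** The triangle picked does not matter: at a point of two closed triangles, conformity provides
    common weights, and both affine formulas equal the sum of [t j * u j] over all nodes. *)
Lemma interpE u s x : closure (tri s) x -> interp u x = affine_interp s u x.
Proof.
move=> xs; rewrite /interp.
case: pickP => [s' /asboolP xs'|/(_ s)/asboolP//].
have [t [t0 t0' tb tb']] := closure_triI xs xs'.
have full s1 : (forall j, j \notin verts s1 -> t j = 0) ->
    \sum_k t (vert s1 k) * u (vert s1 k) = \sum_j t j * u j.
  move=> ts; rewrite -(big_verts s1 (fun j => t j * u j)) [LHS]big_mkcond.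
  by apply: eq_bigr => j _; case: ifPn => // /ts ->; rewrite mul0r.
by rewrite (affine_interp_bary u tb) (affine_interp_bary u tb') !full.
Qed.

Lemma interp_node u j : interp u (node j) = u j.
Proof.
have [s /imsetP[k _ ->]] := node_used j.
rewrite (interpE u (@corner_closure _ _ s k)).
rewrite (@affine_interp_bary _ _ s u (fun i => (i == vert s k)%:R)).
  rewrite (bigD1 k) //= eqxx mul1r big1 ?addr0 // => i ik.
  by rewrite (inj_eq (@vert_inj _ _ s)) (negPf ik) mul0r.
split; rewrite (bigD1 k) //= eqxx big1 ?addr0 ?scale1r // => i ik;
  by rewrite (inj_eq (@vert_inj _ _ s)) (negPf ik) ?scale0r.
Qed.

Lemma affine_interpE u s : exists (g : vec3 R) (c : R),
  forall x, affine_interp s u x = dot g x + c.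
Proof.
exists (dgrad s u), (u (vert s 0) - dot (dgrad s u) (corner s 0)) => x.
by rewrite /affine_interp dotBr; ring.
Qed.

Lemma continuous_affine_interp u s : continuous (affine_interp s u).
Proof.
have [g [c gE]] := affine_interpE u s; rewrite (funext gE).
by apply: continuous_addf; [exact: continuous_dot | exact: continuous_cstf].
Qed.

(** Pasting over a finite closed cover. *)
Lemma within_surface_continuous (f : vec3 R -> R) :
  (forall s : triangles M, {within closure (tri s), continuous f}) ->
  {within surface M, continuous f}.
Proof.
move=> cf; have -> : surface M =
    \big[setU/set0]_(s <- enum (triangles M)) closure (tri s).
  rewrite -bigcup_seq /surface; congr (\bigcup_(s in _) _).
  by apply/seteqP; split=> // s _; rewrite /= mem_enum.
elim: (enum _) => [|s r ih].
  by rewrite big_nil; apply/subspace_continuousP.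
rewrite big_cons; apply: withinU_continuous => //; first exact: closed_closure.
by apply: closed_bigsetU => *; exact: closed_closure.
Qed.

Lemma interp_Sh u : Sh M (interp u).
Proof.
split=> [|s].
  apply: within_surface_continuous => s.
  apply: (@subspace_eq_continuous _ _ _ (affine_interp s u)).
    by move=> x; rewrite inE => xs; exact/esym/interpE.
  exact/continuous_subspaceT/continuous_affine_interp.
have [g [c gE]] := affine_interpE u s; exists g, c => x xs.
by rewrite (interpE u (subset_closure xs)).
Qed.

End Interpolation.

(** * Anisotropy and the double well *)

Lemma cPsi_gt0 (R : realType) : 0 < cPsi R.
Proof.
pose f (s : R) : R := Num.sqrt (2 * Psi s).
(* The real integral is [fine] of the extended one, which is 0 at infinity; hence finiteness has to
   be shown along with positivity. *)
change (0 < fine (\int[lebesgue_measure]_(s in `[(-1)%R, 1%R]) (f s)%:E)%E).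
have f_ge0 s : 0 <= f s by exact: sqrtr_ge0.
have cPs : continuous (fun s : R => 2 * Psi s).
  apply: continuous_mulf; first exact: continuous_cstf.
  apply: continuous_mulf; first exact: continuous_cstf.
  have c1 : continuous (fun s : R => 1 - s ^+ 2).
    apply: continuous_subf; first exact: continuous_cstf.
    exact: exprn_continuous.
  move=> s; apply: (cvg_comp (fun s : R => 1 - s ^+ 2) (fun x => x ^+ 2) (c1 s)).
  exact: exprn_continuous.
have cf : continuous f.
  move=> s; apply: (cvg_comp _ Num.sqrt (cPs s)); exact: sqrt_continuous.
have mf A : measurable_fun A f.
  exact: measurable_funTS (measurable_realfun.continuous_measurable_fun cf).
have intf : lebesgue_measure.-integrable `[(-1 : R), 1] (EFin \o f).
  apply: continuous_compact_integrable; first exact: segment_compact.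
  exact: continuous_subspaceT.
apply: fine_gt0; apply/andP; split; last first.
  have : (\int[lebesgue_measure]_(s in `[(-1)%R, 1%R]) (f s)%:E)%E \is a fin_num.
    exact: integrable_fin_num intf.
  by rewrite fin_numElt => /andP[].
(* For [s] in [[0, 1/2]] one has [2 Psi(s) >= (3/4)^2 / 2 >= 1/4], so the integrand is at least
   [1/2] there. *)
have sub : (`[0, 2^-1] : set R) `<=` `[-1, 1].
  by move=> s /=; rewrite !in_itv /= => /andP[s0 s1]; apply/andP; split; lra.
apply: (@lt_le_trans _ _ (\int[lebesgue_measure]_(s in `[0%R, 2^-1%R]) (2^-1)%:E)%E).
  rewrite integral_cst //= lebesgue_measure_itv /= lte_fin invr_gt0 ltr0n /=.
  by rewrite -EFinB -EFinM lte_fin subr0 mulr_gt0 // invr_gt0.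
apply: (@le_trans _ _ (\int[lebesgue_measure]_(s in `[0%R, 2^-1%R]) (f s)%:E)%E).
  apply: ge0_le_integral => //.
    apply/measurable_realfun.measurable_EFinP; exact: mf.
  move=> s /=; rewrite in_itv /= => /andP[s0 s1]; rewrite lee_fin /f.
  rewrite -[X in X <= _]ger0_norm ?invr_ge0 // -sqrtr_sqr ler_wsqrtr // /Psi.
  have : s ^+ 2 <= 4^-1 by nra.
  move: (s ^+ 2) => t t4; nra.
apply: ge0_subset_integral => //; last by move=> s _; rewrite lee_fin.
by apply/measurable_realfun.measurable_EFinP; exact: mf.
Qed.

(** With [X] and [Y] the sums of [x] and [y], expand the nonnegative sum of
    [(x_i - (X/Y) y_i)^2 / y_i]. *)
Lemma weighted_cauchy (R : realFieldType) (I : finType) (x y : I -> R) :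
  (forall i, 0 < y i) -> 0 < \sum_i y i ->
  (\sum_i x i) ^+ 2 <= (\sum_i y i) * \sum_i (y i)^-1 * x i ^+ 2.
Proof.
move=> y0 Y0; set X := \sum_i x i; set Y := \sum_i y i in Y0 *.
set Z := \sum_i _ * _.
have : 0 <= \sum_i (y i)^-1 * (x i - X / Y * y i) ^+ 2.
  by apply: sumr_ge0 => i _; rewrite mulr_ge0 ?sqr_ge0 // invr_ge0 ltW.
have -> : \sum_i (y i)^-1 * (x i - X / Y * y i) ^+ 2 =
    Z - 2 * (X / Y) * X + (X / Y) ^+ 2 * Y.
  move: (X / Y) => c; rewrite !mulr_sumr -sumrB -big_split /=.
  by apply: eq_bigr => i _; field; rewrite gt_eqF.
have -> : Z - 2 * (X / Y) * X + (X / Y) ^+ 2 * Y = (Y * Z - X ^+ 2) / Y.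
  by field; rewrite gt_eqF.
by rewrite pmulr_lge0 ?invr_gt0 // subr_ge0.
Qed.

Lemma dot_mulmxE (R : realType) (A : 'M[R]_3) (p q : vec3 R) :
  dot q (A *m p) = \sum_i \sum_j q i 0 * (A i j * p j 0).
Proof. by apply: eq_bigr => i _; rewrite mxE mulr_sumr. Qed.

Section SymPosDef.
Context (R : realType) (A : 'M[R]_3).
Hypothesis A_pd : sym_posdef A.
Implicit Types (p q : vec3 R).

Lemma posdef_sym p q : dot q (A *m p) = dot p (A *m q).
Proof.
have [As _] := A_pd; rewrite !dot_mulmxE exchange_big.
apply: eq_bigr => i _; apply: eq_bigr => j _.
by rewrite -{1}As mxE; ring.
Qed.

Lemma posdef_ge0 p : 0 <= dot p (A *m p).
Proof.
have [_ pos] := A_pd; have [->|/pos/ltW//] := eqVneq p 0.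
by rewrite dot0l.
Qed.

Lemma posdef_cauchy p q : dot p (A *m q) <=
  Num.sqrt (dot p (A *m p)) * Num.sqrt (dot q (A *m q)).
Proof.
rewrite -sqrtrM ?posdef_ge0 //; apply: le_trans (ler_norm _) _.
rewrite -sqrtr_sqr ler_wsqrtr //.
have [_ pos] := A_pd; have [->|/pos q0] := eqVneq q 0.
  by rewrite (posdef_sym 0) !dot0l mulr0 expr0n.
(* This [t] minimises the form at [p - t q]; its value there is the Cauchy-Schwarz defect over the
   form at [q]. *)
set t := dot p (A *m q) / dot q (A *m q).
have := posdef_ge0 (p - t *: q).
rewrite mulmxBr -scalemxAr dotBl !dotBr !dotZl !dotZr (posdef_sym p q).
rewrite [X in 0 <= X](_ : _ = (dot p (A *m p) * dot q (A *m q) - dot p (A *m q) ^+ 2)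
  / dot q (A *m q)).
  by rewrite pmulr_lge0 ?invr_gt0 // subr_ge0.
by rewrite /t; field; rewrite gt_eqF.
Qed.

End SymPosDef.

Section Anisotropic.
Context (R : realType) (L : nat) (G : 'I_L -> vec3 R -> 'M[R]_3) (z : vec3 R).
Hypothesis (L_gt0 : (0 < L)%N) (G_pd : forall l, sym_posdef (G l z)).
Implicit Types (p q r : vec3 R).

Lemma dot_Bmx q p r : dot (Bmx G z q *m p) r =
  if q == 0 then L%:R * \sum_l dot r (G l z *m p)
  else gamma G z q * \sum_l (gammal G l z q)^-1 * dot r (G l z *m p).
Proof.
rewrite dotC /Bmx; case: ifP => _; rewrite -scalemxAl dotZr mulmx_suml.
  by congr (_ * _); elim/big_rec2: _ => [|l x y _ <-];
    rewrite ?dotDr // dotC dot0l.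
congr (_ * _); elim/big_rec2: _ => [|l x y _ <-]; first by rewrite dotC dot0l.
by rewrite dotDr -scalemxAl dotZr.
Qed.

Lemma gammal_ge0 l p : 0 <= gammal G l z p.
Proof. exact: sqrtr_ge0. Qed.

Lemma gammal_gt0 l p : p != 0 -> 0 < gammal G l z p.
Proof. by move=> p0; rewrite sqrtr_gt0; apply: (G_pd l).2. Qed.

Lemma gammal_sqr l p : gammal G l z p ^+ 2 = dot p (G l z *m p).
Proof. by rewrite sqr_sqrtr // posdef_ge0. Qed.

Lemma gamma_gt0 p : p != 0 -> 0 < gamma G z p.
Proof.
move=> p0; rewrite /gamma (bigD1 (Ordinal L_gt0)) //= ltr_pwDl ?gammal_gt0 //.
by apply: sumr_ge0 => l _; exact: gammal_ge0.
Qed.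

Lemma dot_Bmx_sym q p r : dot (Bmx G z q *m p) r = dot (Bmx G z q *m r) p.
Proof.
rewrite !dot_Bmx; case: ifP => _; congr (_ * _); apply: eq_bigr => l _;
  by rewrite (posdef_sym (G_pd l)).
Qed.

Lemma dot_Bmx_ge0 q p : 0 <= dot (Bmx G z q *m p) p.
Proof.
rewrite dot_Bmx; case: ifPn => q0.
  by rewrite mulr_ge0 ?ler0n // sumr_ge0 // => l _; exact: posdef_ge0.
rewrite mulr_ge0 ?(ltW (gamma_gt0 q0)) // sumr_ge0 // => l _.
by rewrite mulr_ge0 ?invr_ge0 ?gammal_ge0 // posdef_ge0.
Qed.

Lemma Bmx_energy q p :
  2^-1 * gamma G z p ^+ 2 - 2^-1 * gamma G z q ^+ 2
  <= dot (Bmx G z q *m p) (p - q).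
Proof.
(* A sharper bound, from which the claim follows by [2xy <= x^2 + y^2]. *)
suff : gamma G z p ^+ 2 - gamma G z p * gamma G z q
    <= dot (Bmx G z q *m p) (p - q).
  apply: le_trans; have := sqr_ge0 (gamma G z p - gamma G z q).
  by move: (gamma G z p) (gamma G z q) => x y; nra.
rewrite dot_Bmx; case: ifPn => q0.
  rewrite (eqP q0) subr0.
  have -> : gamma G z 0 = 0.
    by rewrite /gamma big1 // => l _; rewrite /gammal dot0l sqrtr0.
  rewrite mulr0 subr0.
  (* Unit weights: the total weight [L] is exactly the factor in [Bmx] at [q = 0]. *)
  have := @weighted_cauchy R 'I_L (gammal G ^~ z ^~ p) (fun=> 1).
  rewrite sumr_const card_ord ltr0n L_gt0 => /(_ (fun=> ltr01) isT).
  move/le_trans; apply; rewrite ler_wpM2l ?ler0n //; apply: ler_sum => l _.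
  by rewrite /= invr1 mul1r gammal_sqr.
(* The first comparison is Cauchy-Schwarz over [l] with weights [gammal l z q]; the second is
   [posdef_cauchy] for each [l], applied to the mixed term. *)
apply: (@le_trans _ _ (gamma G z q * \sum_l (gammal G l z q)^-1 *
    (gammal G l z p ^+ 2 - gammal G l z p * gammal G l z q))).
  have -> : \sum_l (gammal G l z q)^-1 *
      (gammal G l z p ^+ 2 - gammal G l z p * gammal G l z q) =
      \sum_l (gammal G l z q)^-1 * gammal G l z p ^+ 2 - gamma G z p.
    rewrite -sumrB; apply: eq_bigr => l _.
    by field; rewrite gt_eqF // gammal_gt0.
  rewrite mulrBr [gamma G z p * _]mulrC lerD2r; apply: weighted_cauchy.
    by move=> l; exact: gammal_gt0.
  exact: gamma_gt0.
rewrite ler_pM2l ?gamma_gt0 //; apply: ler_sum => l _.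
rewrite ler_pM2l ?invr_gt0 ?gammal_gt0 // gammal_sqr dotBl lerD2l lerN2 mulrC.
exact: posdef_cauchy.
Qed.

End Anisotropic.

(** The gap between the two sides factors as [(x - y)^2 (2 x^2 + (x + y)^2 + 2) / 4]. *)
Lemma Psi_energy (R : realType) (x y : R) :
  Psi x - Psi y <= (phip x + phim y) * (x - y).
Proof.
rewrite /Psi /phip /phim -subr_ge0.
rewrite (_ : _ - _ = 4^-1 * (x - y) ^+ 2 * (2 * x ^+ 2 + (x + y) ^+ 2 + 2)).
  apply: mulr_ge0; first by rewrite mulr_ge0 ?invr_ge0 ?sqr_ge0.
  by have := sqr_ge0 x; have := sqr_ge0 (x + y); lra.
by field.
Qed.

(** * Traces and mass lumping *)

Section TraceAlgebra.
Context (R : realType) (M : mesh R) (s : triangles M) (k : 'I_3).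
Implicit Types (f g : vec3 R -> R).

(** Convergence rather than the value of [lim], since only convergent limits pass through sums and
    products. *)
Definition has_trace f (l : R) :=
  f x @[x --> within (tri s) (nbhs (corner s k))] --> l.

Lemma has_trace_lim f l : has_trace f l -> trace_at s k f = l.
Proof.
move=> fl; have FF := within_tri_proper (@corner_closure _ _ s k).
exact: cvg_lim fl.
Qed.

Lemma has_trace_eq f g l : (forall x, tri s x -> f x = g x) ->
  has_trace g l -> has_trace f l.
Proof.
move=> fg; apply: cvg_trans; apply: near_eq_cvg; rewrite near_withinE.
by apply: filterE => x xs; rewrite fg.
Qed.

Lemma has_trace_cst c : has_trace (fun=> c) c.
Proof. exact: cvg_cst. Qed.

Lemma has_traceD f g a b : has_trace f a -> has_trace g b ->
  has_trace (fun x => f x + g x) (a + b).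
Proof. by move=> fa gb; apply: cvgD. Qed.

Lemma has_traceB f g a b : has_trace f a -> has_trace g b ->
  has_trace (fun x => f x - g x) (a - b).
Proof. by move=> fa gb; apply: cvgB. Qed.

Lemma has_traceM f g a b : has_trace f a -> has_trace g b ->
  has_trace (fun x => f x * g x) (a * b).
Proof. by move=> fa gb; apply: cvgM. Qed.

Lemma has_traceX f a n : has_trace f a -> has_trace (fun x => f x ^+ n) (a ^+ n).
Proof.
by move=> fa; apply: (cvg_comp f (fun t => t ^+ n) fa); exact: exprn_continuous.
Qed.

Lemma has_trace_sqrt f a :
  has_trace f a -> has_trace (fun x => Num.sqrt (f x)) (Num.sqrt a).
Proof. by move=> fa; apply: (cvg_comp f Num.sqrt fa); exact: sqrt_continuous. Qed.

Lemma has_traceV f a : a != 0 -> has_trace f a -> has_trace (fun x => (f x)^-1) a^-1.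
Proof. by move=> a0 fa; apply: cvgV. Qed.

Lemma has_trace_sum (I : finType) (F : I -> vec3 R -> R) (A : I -> R) :
  (forall i, has_trace (F i) (A i)) ->
  has_trace (fun x => \sum_i F i x) (\sum_i A i).
Proof. by move=> FA; apply: cvg_bigsum. Qed.

Lemma has_trace_continuous f : {within surface M, continuous f} ->
  has_trace f (f (corner s k)).
Proof. by move=> cf; apply: cvg_within_tri => //; exact: corner_closure. Qed.

Lemma has_trace_Sh f : Sh M f -> has_trace f (f (corner s k)).
Proof. by case=> cf _; exact: has_trace_continuous. Qed.

(** The gradient is constant on the triangle, so only the explicit dependence of [F] on the point
    remains. *)
Lemma has_trace_sgrad (F : vec3 R -> vec3 R -> R) f l : Sh M f ->
  has_trace (fun x => F x (dgrad s (fun j : nodes M => f (node j)))) l ->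
  has_trace (fun x => F x (sgrad M f x)) l.
Proof.
by move=> Sf; apply: has_trace_eq => x xs; rewrite (sgrad_dgrad Sf xs).
Qed.

Section Anisotropy.
Context (L : nat) (G : 'I_L -> vec3 R -> 'M[R]_3).
Hypothesis (L_gt0 : (0 < L)%N)
  (G_cont : forall l, {within surface M, continuous (G l)})
  (G_pd : forall l z, surface M z -> sym_posdef (G l z)).

Let corner_pd l : sym_posdef (G l (corner s k)).
Proof. exact/G_pd/closure_tri_surface/corner_closure. Qed.

Lemma has_trace_form l p q : has_trace (fun x => dot p (G l x *m q))
  (dot p (G l (corner s k) *m q)).
Proof.
have cdot : continuous (fun A : 'M[R]_3 => dot p (A *m q)).
  under eq_fun do rewrite dot_mulmxE.
  apply: continuous_sumf => i; apply: continuous_sumf => j.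
  apply: continuous_mulf; first exact: continuous_cstf.
  by apply: continuous_mulf; [exact: coord_continuous | exact: continuous_cstf].
have Gc := cvg_within_tri (@G_cont l) (@corner_closure _ _ s k).
exact: (cvg_comp (G l) (fun A => dot p (A *m q)) Gc (cdot _)).
Qed.

Lemma has_trace_gammal l q :
  has_trace (fun x => gammal G l x q) (gammal G l (corner s k) q).
Proof. exact/has_trace_sqrt/has_trace_form. Qed.

Lemma has_trace_gamma q :
  has_trace (fun x => gamma G x q) (gamma G (corner s k) q).
Proof. by apply: has_trace_sum => l; exact: has_trace_gammal. Qed.

(** The case distinction in [Bmx] concerns the fixed [q], so each branch is continuous in the point;
    for [q != 0] the denominators are positive. *)
Lemma has_trace_Bmx q p r : has_trace (fun x => dot (Bmx G x q *m p) r)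
  (dot (Bmx G (corner s k) q *m p) r).
Proof.
under eq_fun do rewrite dot_Bmx; rewrite dot_Bmx; case: ifPn => q0.
  apply: has_traceM; first exact: has_trace_cst.
  by apply: has_trace_sum => l; exact: has_trace_form.
apply: has_traceM; first exact: has_trace_gamma.
apply: has_trace_sum => l; apply: has_traceM; last exact: has_trace_form.
apply: has_traceV; last exact: has_trace_gammal.
by rewrite gt_eqF // gammal_gt0.
Qed.

End Anisotropy.
End TraceAlgebra.

Section CornerSums.
Context (R : realType) (M : mesh R).
Implicit Types (f g : vec3 R -> R) (h : triangles M -> 'I_3 -> R).

(** [lumped] with the corner limits replaced by given numbers. *)
Definition corner_sum h : R :=
  \sum_(s : triangles M) 3^-1 * area s * \sum_(k < 3) h s k.

Lemma lumpedE f h : (forall s k, has_trace s k f (h s k)) ->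
  lumped M f = corner_sum h.
Proof.
move=> fh; apply: eq_bigr => s _; congr (_ * _); apply: eq_bigr => k _.
exact: has_trace_lim.
Qed.

Lemma innerE f g h1 h2 : (forall s k, has_trace s k f (h1 s k)) ->
  (forall s k, has_trace s k g (h2 s k)) ->
  inner M f g = corner_sum (fun s k => h1 s k * h2 s k).
Proof. by move=> ? ?; apply: lumpedE => s k; exact: has_traceM. Qed.

Lemma area_gt0 (s : triangles M) : 0 < area s.
Proof. exact: Defs.nondegenerate. Qed.

Lemma eq_corner_sum h1 h2 : (forall s k, h1 s k = h2 s k) ->
  corner_sum h1 = corner_sum h2.
Proof.
by move=> h12; apply: eq_bigr => s _; congr (_ * _); apply: eq_bigr => k _.
Qed.

Lemma corner_sumD h1 h2 :
  corner_sum (fun s k => h1 s k + h2 s k) = corner_sum h1 + corner_sum h2.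
Proof.
rewrite -big_split; apply: eq_bigr => s _ /=.
by rewrite big_split mulrDr.
Qed.

Lemma corner_sumZ c h : corner_sum (fun s k => c * h s k) = c * corner_sum h.
Proof.
rewrite mulr_sumr; apply: eq_bigr => s _ /=.
by rewrite -mulr_sumr mulrCA.
Qed.

Lemma ler_corner_sum h1 h2 : (forall s k, h1 s k <= h2 s k) ->
  corner_sum h1 <= corner_sum h2.
Proof.
move=> h12; apply: ler_sum => s _; rewrite ler_wpM2l ?ler_sum //.
by rewrite mulr_ge0 ?invr_ge0 // ltW // area_gt0.
Qed.

Lemma corner_sum_ge0 h : (forall s k, 0 <= h s k) -> 0 <= corner_sum h.
Proof.
move=> h0; apply: sumr_ge0 => s _; rewrite mulr_ge0 ?sumr_ge0 //.
by rewrite mulr_ge0 ?invr_ge0 // ltW // area_gt0.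
Qed.

Lemma corner_sum_eq0 h : (forall s k, 0 <= h s k) -> corner_sum h = 0 ->
  forall s k, h s k = 0.
Proof.
move=> h0 /eqP; rewrite psumr_eq0 => [/allP hs s k|s _]; last first.
  by rewrite mulr_ge0 ?sumr_ge0 // mulr_ge0 ?invr_ge0 // ltW // area_gt0.
have w0 : 0 < 3^-1 * area s by rewrite mulr_gt0 ?invr_gt0 // area_gt0.
have := hs s; rewrite mem_index_enum mulf_eq0 (gt_eqF w0) /= psumr_eq0 // => /(_ isT)/allP/(_ k).
by rewrite mem_index_enum => /(_ isT)/eqP.
Qed.

(** Regroups corners by node. For [h = 1] this is the diagonal of the lumped mass matrix, positive
    because every node belongs to a triangle. *)
Definition node_weight h (j : nodes M) : R :=
  \sum_(s : triangles M) \sum_(k < 3 | vert s k == j) 3^-1 * area s * h s k.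

Lemma corner_sum_nodes h (x : nodes M -> R) :
  corner_sum (fun s k => h s k * x (vert s k)) = \sum_j node_weight h j * x j.
Proof.
under [RHS]eq_bigr do rewrite mulr_suml; rewrite exchange_big.
apply: eq_bigr => s _; rewrite mulr_sumr (partition_big (vert s) xpredT) //=.
apply: eq_bigr => j _; rewrite mulr_suml; apply: eq_bigr => k /eqP <-.
by rewrite mulrA.
Qed.

Lemma node_weight1_gt0 j : 0 < node_weight (fun _ _ => 1) j.
Proof.
have [s /imsetP[k _ ->]] := node_used j.
have w0 (t : triangles M) (i : 'I_3) : 0 <= 3^-1 * area t * 1.
  by rewrite mulr1 mulr_ge0 ?invr_ge0 // ltW // area_gt0.
rewrite /node_weight (bigD1 s) //= ltr_pwDl //; last first.
  by apply: sumr_ge0 => t _; apply: sumr_ge0 => i _; exact: w0.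
rewrite (bigD1 k) //= ltr_pwDl //; last by apply: sumr_ge0 => i _; exact: w0.
by rewrite mulr1 mulr_gt0 ?invr_gt0 // area_gt0.
Qed.

Lemma node_weightZ (x : nodes M -> R) j :
  node_weight (fun s k => x (vert s k)) j = node_weight (fun _ _ => 1) j * x j.
Proof.
rewrite mulr_suml; apply: eq_bigr => s _; rewrite mulr_suml.
by apply: eq_bigr => k /eqP ->; rewrite mulr1.
Qed.

End CornerSums.

(** * The nodal system *)

Lemma cube_mono (R : realFieldType) (x y : R) : 0 <= (x ^+ 3 - y ^+ 3) * (x - y).
Proof.
have -> : (x ^+ 3 - y ^+ 3) * (x - y)
    = 2^-1 * (x - y) ^+ 2 * (x ^+ 2 + y ^+ 2 + (x + y) ^+ 2) by field.
apply: mulr_ge0; first by rewrite mulr_ge0 ?invr_ge0 ?sqr_ge0.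
by have := sqr_ge0 x; have := sqr_ge0 y; have := sqr_ge0 (x + y); lra.
Qed.

Lemma cube_mono_eq0 (R : realFieldType) (x y : R) :
  (x ^+ 3 - y ^+ 3) * (x - y) = 0 -> x = y.
Proof.
have -> : (x ^+ 3 - y ^+ 3) * (x - y)
    = 2^-1 * (x - y) ^+ 2 * (x ^+ 2 + y ^+ 2 + (x + y) ^+ 2) by field.
move=> /eqP; rewrite !mulf_eq0 invr_eq0 pnatr_eq0 /= orbb subr_eq0.
move=> /orP[/eqP//|/eqP h]; have := sqr_ge0 x; have := sqr_ge0 y.
have := sqr_ge0 (x + y) => h1 h2 h3.
have /eqP : x ^+ 2 = 0 by lra.
have /eqP : y ^+ 2 = 0 by lra.
by rewrite !sqrf_eq0 => /eqP -> /eqP ->.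
Qed.

Lemma dgrad_subr (R : realType) (M : mesh R) (s : triangles M)
  (u v : nodes M -> R) : dgrad s (fun j => u j - v j) = dgrad s u - dgrad s v.
Proof.
rewrite (_ : (fun j => u j - v j) = (fun j => -1 * v j + u j)); last first.
  by apply/funext => j; ring.
by rewrite dgrad_linear scaleN1r addrC.
Qed.

Lemma dgrad_subr_cst (R : realType) (M : mesh R) (s : triangles M)
  (u : nodes M -> R) c : dgrad s (fun j => u j - c) = dgrad s u.
Proof. by rewrite /dgrad; apply/matrixP => i j; rewrite !mxE; ring. Qed.

Section DiscreteScheme.
Context (R : realType) (M : mesh R) (N : pred (nodes M)).
Context (m : triangles M -> 'I_3 -> R) (B : triangles M -> 'I_3 -> 'M[R]_3).
Context (gam : triangles M -> 'I_3 -> vec3 R -> R).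
Context (eps alpha a lambda K theta rho wD tau c : R) (u0 w0 : nodes M -> R).
Hypothesis (eps_gt0 : 0 < eps) (alpha_gt0 : 0 < alpha) (a_gt0 : 0 < a)
  (lambda_gt0 : 0 < lambda) (K_gt0 : 0 < K) (theta_ge0 : 0 <= theta)
  (rho_ge0 : 0 <= rho) (tau_gt0 : 0 < tau) (c_gt0 : 0 < c).
Hypothesis (m_gt0 : forall s k, 0 < m s k).
Hypothesis (B_sym : forall s k p q, dot (B s k *m p) q = dot (B s k *m q) p)
  (B_ge0 : forall s k p, 0 <= dot (B s k *m p) p).
(** [B s k] stands for the matrix frozen at the old gradient, so the inequality is asked for that
    [q] alone. *)
Hypothesis (B_energy : forall s k p q, q = dgrad s u0 ->
  2^-1 * gam s k p ^+ 2 - 2^-1 * gam s k q ^+ 2 <= dot (B s k *m p) (p - q)).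

Definition discrete_step (u w : nodes M -> R) : Prop :=
  [/\ forall j, N j -> w j = wD,
      forall x, (forall j, N j -> x j = 0) ->
        theta * corner_sum (fun s k =>
          (w (vert s k) - w0 (vert s k)) / tau * x (vert s k))
        + 2^-1 * lambda * corner_sum (fun s k =>
          (u (vert s k) - u0 (vert s k)) / tau * x (vert s k))
        + corner_sum (fun s k => dot (K *: dgrad s w) (dgrad s x)) = 0
    & forall x, eps * (rho / alpha) * corner_sum (fun s k =>
          m s k * ((u (vert s k) - u0 (vert s k)) / tau) * x (vert s k))
        + eps * corner_sum (fun s k => dot (B s k *m dgrad s u) (dgrad s x))
        + eps^-1 * corner_sum (fun s k => phip (u (vert s k)) * x (vert s k))
        = corner_sum (fun s k => (2^-1 * c * (a / alpha) * w (vert s k)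
            - eps^-1 * phim (u0 (vert s k))) * x (vert s k))].

Definition discrete_energy (u w : nodes M -> R) : R :=
  theta / 2 * corner_sum (fun s k => (w (vert s k) - wD) * (w (vert s k) - wD))
  + lambda * alpha / a * c^-1
    * (2^-1 * eps * corner_sum (fun s k =>
         gam s k (dgrad s u) * gam s k (dgrad s u))
       + eps^-1 * corner_sum (fun s k => Psi (u (vert s k)) * 1))
  - lambda * wD * corner_sum (fun s k => 2^-1 * (1 + u (vert s k))).

(** The first equation gives the sign of the coupling term, the second then forces [u' = u] by
    strict monotonicity of the cube. Equality of [w] and [w'] is read off the second equation, since
    the first may control only their gradients. *)
Lemma discrete_step_unique u w u' w' : discrete_step u w ->
  discrete_step u' w' -> u' = u /\ w' = w.
Proof.
move=> [wN eq1 eq2] [wN' eq1' eq2'].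
pose du j := u' j - u j; pose dw j := w' j - w j.
have dwN j : N j -> dw j = 0 by move=> Nj; rewrite /dw wN // wN' // subrr.
pose X := corner_sum (fun s k => dw (vert s k) * dw (vert s k)).
pose Y := corner_sum (fun s k => du (vert s k) * dw (vert s k)).
pose S := corner_sum (fun s k => dot (dgrad s dw) (dgrad s dw)).
pose U := corner_sum (fun s k => m s k * (du (vert s k) * du (vert s k))).
pose V := corner_sum (fun s k => dot (B s k *m dgrad s du) (dgrad s du)).
pose P := corner_sum (fun s k => (u' (vert s k) ^+ 3 - u (vert s k) ^+ 3)
   * (u' (vert s k) - u (vert s k))).
have X0 : 0 <= X by apply: corner_sum_ge0 => s k; rewrite -expr2 sqr_ge0.
have S0 : 0 <= S by apply: corner_sum_ge0 => s k; exact: dot_ge0.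
have U0 : 0 <= U.
  apply: corner_sum_ge0 => s k; apply: mulr_ge0; first exact/ltW/m_gt0.
  by rewrite -expr2 sqr_ge0.
have V0 : 0 <= V by apply: corner_sum_ge0 => s k; exact: B_ge0.
have Pk s k : 0 <= (u' (vert s k) ^+ 3 - u (vert s k) ^+ 3)
   * (u' (vert s k) - u (vert s k)) by exact: cube_mono.
have P0 : 0 <= P by exact: corner_sum_ge0.
have h1 : theta / tau * X + lambda / (2 * tau) * Y + K * S = 0.
  have := eq1' dw dwN; have := eq1 dw dwN.
  rewrite (_ : corner_sum (fun s k => (w' (vert s k) - w0 (vert s k)) / tau
      * dw (vert s k)) = corner_sum (fun s k => (w (vert s k) - w0 (vert s k))
      / tau * dw (vert s k)) + tau^-1 * X); last first.
    rewrite -corner_sumZ -corner_sumD; apply: eq_corner_sum => s k.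
    by rewrite /dw; ring.
  rewrite (_ : corner_sum (fun s k => (u' (vert s k) - u0 (vert s k)) / tau
      * dw (vert s k)) = corner_sum (fun s k => (u (vert s k) - u0 (vert s k))
      / tau * dw (vert s k)) + tau^-1 * Y); last first.
    rewrite -corner_sumZ -corner_sumD; apply: eq_corner_sum => s k.
    by rewrite /du; ring.
  rewrite (_ : corner_sum (fun s k => dot (K *: dgrad s w') (dgrad s dw))
    = corner_sum (fun s k => dot (K *: dgrad s w) (dgrad s dw)) + K * S); last first.
    rewrite -corner_sumZ -corner_sumD; apply: eq_corner_sum => s k.
    by rewrite /dw dgrad_subr !dotZl !dotBl; ring.
  have -> : lambda / (2 * tau) = 2^-1 * lambda * tau^-1.
    by field; rewrite gt_eqF.
  by move=> ? ?; lra.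
have h2 x : eps * (rho / alpha) * corner_sum (fun s k => m s k *
      (du (vert s k) / tau) * x (vert s k))
    + eps * corner_sum (fun s k => dot (B s k *m dgrad s du) (dgrad s x))
    + eps^-1 * corner_sum (fun s k => (u' (vert s k) ^+ 3 - u (vert s k) ^+ 3)
       * x (vert s k))
    = 2^-1 * c * (a / alpha) * corner_sum (fun s k => dw (vert s k) * x (vert s k)).
  have := eq2' x; have := eq2 x.
  rewrite (_ : corner_sum (fun s k => m s k * ((u' (vert s k) - u0 (vert s k))
      / tau) * x (vert s k)) = corner_sum (fun s k => m s k *
      ((u (vert s k) - u0 (vert s k)) / tau) * x (vert s k)) +
      corner_sum (fun s k => m s k * (du (vert s k) / tau) * x (vert s k)));
    last by rewrite -corner_sumD; apply: eq_corner_sum => s k; rewrite /du; ring.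
  rewrite (_ : corner_sum (fun s k => dot (B s k *m dgrad s u') (dgrad s x))
    = corner_sum (fun s k => dot (B s k *m dgrad s u) (dgrad s x)) +
      corner_sum (fun s k => dot (B s k *m dgrad s du) (dgrad s x))); last first.
    rewrite -corner_sumD; apply: eq_corner_sum => s k.
    by rewrite /du dgrad_subr mulmxBr dotBl; ring.
  rewrite (_ : corner_sum (fun s k => phip (u' (vert s k)) * x (vert s k))
    = corner_sum (fun s k => phip (u (vert s k)) * x (vert s k)) +
      corner_sum (fun s k => (u' (vert s k) ^+ 3 - u (vert s k) ^+ 3)
       * x (vert s k)));
    last by rewrite -corner_sumD; apply: eq_corner_sum => s k; rewrite /phip; ring.
  rewrite (_ : corner_sum (fun s k => (2^-1 * c * (a / alpha) * w' (vert s k)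
      - eps^-1 * phim (u0 (vert s k))) * x (vert s k)) =
    corner_sum (fun s k => (2^-1 * c * (a / alpha) * w (vert s k)
      - eps^-1 * phim (u0 (vert s k))) * x (vert s k)) +
    2^-1 * c * (a / alpha) * corner_sum (fun s k => dw (vert s k) * x (vert s k)));
    last by rewrite -corner_sumZ -corner_sumD; apply: eq_corner_sum => s k;
      rewrite /dw; ring.
  by move=> ? ?; lra.
have kap0 : 0 < 2^-1 * c * (a / alpha) by rewrite !mulr_gt0 ?invr_gt0.
(* In [h1] the other two terms are nonnegative. *)
have Yle0 : Y <= 0.
  have l0 : 0 < lambda / (2 * tau) by rewrite divr_gt0 // mulr_gt0.
  rewrite -(pmulr_rle0 _ l0).
  have : 0 <= theta / tau * X by rewrite mulr_ge0 // divr_ge0 // ltW.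
  have : 0 <= K * S by rewrite mulr_ge0 // ltW.
  by lra.
(* Testing with [du] makes a sum of nonnegative terms equal to a positive multiple of [Y]. *)
have Peq0 : P = 0.
  have := h2 du; rewrite -/V -/P.
  rewrite (_ : corner_sum (fun s k => m s k * (du (vert s k) / tau) * du (vert s k))
    = tau^-1 * U);
    last by rewrite -corner_sumZ; apply: eq_corner_sum => s k; ring.
  rewrite (_ : corner_sum (fun s k => dw (vert s k) * du (vert s k)) = Y);
    last by apply: eq_corner_sum => s k; rewrite mulrC.
  move=> h; apply/eqP; rewrite eq_le P0 andbT.
  have e0 : 0 < eps^-1 by rewrite invr_gt0.
  rewrite -(pmulr_rle0 _ e0).
  have : 0 <= eps * (rho / alpha) * (tau^-1 * U).
    apply: mulr_ge0; last by rewrite mulr_ge0 // invr_ge0 ltW.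
    by apply: mulr_ge0; [exact: ltW | rewrite divr_ge0 // ltW].
  have : 0 <= eps * V by rewrite mulr_ge0 // ltW.
  have : 2^-1 * c * (a / alpha) * Y <= 0 by rewrite pmulr_rle0.
  by lra.
have u'u : u' = u.
  apply/funext => j; have [s /imsetP[k _ ->]] := node_used j.
  exact: cube_mono_eq0 (corner_sum_eq0 Pk Peq0 s k).
split=> //; apply/funext => j; have [s /imsetP[k _ ->]] := node_used j.
have du0 : du = (fun=> 0) by rewrite /du u'u; apply/funext => i; rewrite subrr.
(* With [du = 0] the second equation tested with [dw] leaves only the lumped square of [dw]. *)
have X00 : X = 0.
  have := h2 dw; rewrite u'u du0 -/X.
  rewrite (_ : corner_sum (fun s k => m s k * (0 / tau) * dw (vert s k)) = 0);
    last by apply: big1 => i _; rewrite big1 ?mulr0 // => l _; ring.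
  rewrite (_ : corner_sum (fun s k => dot (B s k *m dgrad s (fun=> 0)) (dgrad s dw))
    = 0); last first.
    apply: big1 => i _; rewrite big1 ?mulr0 // => l _.
    rewrite (_ : dgrad i (fun=> 0) = 0) ?mulmx0 ?dot0l //.
    by apply/matrixP => ? ?; rewrite /dgrad !mxE; ring.
  rewrite (_ : corner_sum (fun s k => (u (vert s k) ^+ 3 - u (vert s k) ^+ 3)
    * dw (vert s k)) = 0);
    last by apply: big1 => i _; rewrite big1 ?mulr0 // => l _; ring.
  rewrite !mulr0 !addr0 => /esym/eqP; rewrite mulf_eq0 (gt_eqF kap0) /=.
  by move/eqP.
have Xk (s' : triangles M) (k' : 'I_3) : 0 <= dw (vert s' k') * dw (vert s' k').
  by rewrite -expr2 sqr_ge0.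
have /eqP := corner_sum_eq0 Xk X00 s k.
by rewrite mulf_eq0 orbb subr_eq0 => /eqP.
Qed.

Lemma discrete_step_exists : exists u w, discrete_step u w.
Proof.
(* The coupling coefficients: [kap] multiplies [w] in the second equation, [bet] multiplies [u] in
   the first. Scaling the unknown by [bet / kap] makes both couplings equal to [bet * mass], as
   [saddle_solution] requires. *)
pose kap := 2^-1 * c * (a / alpha); pose bet := 2^-1 * lambda / tau.
have kap0 : 0 < kap by rewrite !mulr_gt0 ?invr_gt0.
have bet0 : 0 < bet by rewrite !mulr_gt0 ?invr_gt0.
have rt0 : 0 <= eps * (rho / alpha) / tau.
  apply: divr_ge0; last exact: ltW.
  by apply: mulr_ge0; [exact: ltW | rewrite divr_ge0 // ltW].
have tt0 : 0 <= theta / tau by rewrite divr_ge0 // ltW.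
pose fa x y := bet / kap * (theta / tau * corner_sum (fun (s : triangles M) k =>
    x (vert s k) * y (vert s k))
  + K * corner_sum (fun s k => dot (dgrad s x) (dgrad s y))).
pose fb x y := eps * (rho / alpha) / tau * corner_sum (fun s k =>
    m s k * (x (vert s k) * y (vert s k)))
  + eps * corner_sum (fun s k => dot (B s k *m dgrad s x) (dgrad s y)).
have fa_psd : psd_form fa.
  split=> [z t x y|x y|x]; rewrite /fa.
  - rewrite (_ : corner_sum (fun s k => (t * x (vert s k) + y (vert s k))
       * z (vert s k)) = t * corner_sum (fun s k => x (vert s k) * z (vert s k))
       + corner_sum (fun s k => y (vert s k) * z (vert s k))); last first.
      by rewrite -corner_sumZ -corner_sumD; apply: eq_corner_sum => s k; ring.
    rewrite (_ : corner_sum (fun s k => dot (dgrad s (fun j => t * x j + y j))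
        (dgrad s z)) = t * corner_sum (fun s k => dot (dgrad s x) (dgrad s z))
        + corner_sum (fun s k => dot (dgrad s y) (dgrad s z))); last first.
      rewrite -corner_sumZ -corner_sumD; apply: eq_corner_sum => s k.
      by rewrite dgrad_linear dotDl dotZl.
    by ring.
  - congr (_ * (_ * _ + _ * _)); apply: eq_corner_sum => s k; first exact: mulrC.
    exact: dotC.
  - apply: mulr_ge0; first by rewrite divr_ge0 // ltW.
    apply: addr_ge0; apply: mulr_ge0 => //; first 1 last.
    + exact: ltW.
    + by apply: corner_sum_ge0 => s k; exact: dot_ge0.
    by apply: corner_sum_ge0 => s k; rewrite -expr2 sqr_ge0.
have fb_psd : psd_form fb.
  split=> [z t x y|x y|x]; rewrite /fb.
  - rewrite (_ : corner_sum (fun s k => m s k * ((t * x (vert s k) + y (vert s k))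
       * z (vert s k))) = t * corner_sum (fun s k => m s k * (x (vert s k) *
       z (vert s k))) + corner_sum (fun s k => m s k * (y (vert s k) *
       z (vert s k)))); last first.
      by rewrite -corner_sumZ -corner_sumD; apply: eq_corner_sum => s k; ring.
    rewrite (_ : corner_sum (fun s k => dot (B s k *m dgrad s (fun j =>
        t * x j + y j)) (dgrad s z)) =
        t * corner_sum (fun s k => dot (B s k *m dgrad s x) (dgrad s z))
        + corner_sum (fun s k => dot (B s k *m dgrad s y) (dgrad s z))); last first.
      rewrite -corner_sumZ -corner_sumD; apply: eq_corner_sum => s k.
      by rewrite dgrad_linear mulmxDr -scalemxAr dotDl dotZl.
    by ring.
  - congr (_ * _ + _ * _); apply: eq_corner_sum => s k; last exact: B_sym.
    by rewrite [x _ * _]mulrC.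
  - apply: addr_ge0; apply: mulr_ge0 => //.
    + apply: corner_sum_ge0 => s k; apply: mulr_ge0; first exact/ltW/m_gt0.
      by rewrite -expr2 sqr_ge0.
    + exact: ltW.
    + by apply: corner_sum_ge0 => s k; exact: B_ge0.
pose mass := node_weight (fun (_ : triangles M) (_ : 'I_3) => 1 : R).
(* [hf] and [hg] collect the known data of the two equations: old values and the shift by [wD]. *)
pose hf (s : triangles M) (k : 'I_3) : R :=
  theta / tau * (w0 (vert s k) - wD) + bet * u0 (vert s k).
pose hg s k : R := kap * wD + eps^-1 * u0 (vert s k)
  + eps * (rho / alpha) / tau * (m s k * u0 (vert s k)).
have [u [v [vN eqa eqb]]] := @saddle_solution R _ N fa fb (fun j => bet * mass j)
  (fun j => eps^-1 * mass j) (node_weight hf) (node_weight hg) fa_psd fb_psd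
  (fun j => mulr_gt0 bet0 (node_weight1_gt0 j))
  (fun j => mulr_gt0 (etrans (invr_gt0 _) eps_gt0) (node_weight1_gt0 j)).
have massE (d : R) (y x : nodes M -> R) : \sum_j d * mass j * y j * x j =
    d * corner_sum (fun s k => y (vert s k) * x (vert s k)).
  rewrite corner_sum_nodes mulr_sumr; apply: eq_bigr => j _.
  by rewrite (node_weightZ y) -/(mass j); ring.
pose w j := wD + bet / kap * v j.
have dw s : dgrad s w = (bet / kap) *: dgrad s v.
  by rewrite /w /dgrad; apply/matrixP => i j; rewrite !mxE; ring.
exists u, w; split=> [j Nj|x xN|x].
- by rewrite /w vN // mulr0 addr0.
- have := eqa x xN; rewrite massE -corner_sum_nodes /fa /hf.
  rewrite (_ : corner_sum (fun s k => (theta / tau * (w0 (vert s k) - wD)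
      + bet * u0 (vert s k)) * x (vert s k)) = theta / tau * corner_sum (fun s k =>
      (w0 (vert s k) - wD) * x (vert s k)) + bet * corner_sum (fun s k =>
      u0 (vert s k) * x (vert s k)));
    last by rewrite -!corner_sumZ -corner_sumD; apply: eq_corner_sum => s k; ring.
  rewrite (_ : corner_sum (fun s k => (w (vert s k) - w0 (vert s k)) / tau
      * x (vert s k)) = tau^-1 * (bet / kap * corner_sum (fun s k => v (vert s k)
      * x (vert s k)) + -1 * corner_sum (fun s k => (w0 (vert s k) - wD)
      * x (vert s k))));
    last by rewrite -!corner_sumZ -corner_sumD -corner_sumZ;
      apply: eq_corner_sum => s k; rewrite /w; ring.
  rewrite (_ : corner_sum (fun s k => (u (vert s k) - u0 (vert s k)) / tau
      * x (vert s k)) = tau^-1 * (corner_sum (fun s k => u (vert s k) * x (vert s k))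
      + -1 * corner_sum (fun s k => u0 (vert s k) * x (vert s k))));
    last by rewrite -!corner_sumZ -corner_sumD -corner_sumZ;
      apply: eq_corner_sum => s k; ring.
  rewrite (_ : corner_sum (fun s k => dot (K *: dgrad s w) (dgrad s x)) =
      bet / kap * K * corner_sum (fun s k => dot (dgrad s v) (dgrad s x)));
    last by rewrite -corner_sumZ; apply: eq_corner_sum => s k;
      rewrite dw !dotZl; ring.
  by rewrite /bet => ?; lra.
- have := eqb x.
  rewrite (_ : \sum_j eps^-1 * mass j * u j ^+ 3 * x j = eps^-1 * corner_sum
     (fun s k => phip (u (vert s k)) * x (vert s k)));
    last exact: (massE _ (fun j => u j ^+ 3)).
  rewrite massE -corner_sum_nodes /fb /hg.
  rewrite (_ : corner_sum (fun s k => (kap * wD + eps^-1 * u0 (vert s k)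
     + eps * (rho / alpha) / tau * (m s k * u0 (vert s k))) * x (vert s k)) =
     corner_sum (fun s k => (kap * wD + eps^-1 * u0 (vert s k)) * x (vert s k)) +
     eps * (rho / alpha) / tau * corner_sum (fun s k => m s k * (u0 (vert s k)
       * x (vert s k))));
    last by rewrite -!corner_sumZ -corner_sumD; apply: eq_corner_sum => s k; ring.
  rewrite (_ : corner_sum (fun s k => m s k * ((u (vert s k) - u0 (vert s k)) / tau)
     * x (vert s k)) = tau^-1 * (corner_sum (fun s k => m s k * (u (vert s k)
       * x (vert s k))) + -1 * corner_sum (fun s k => m s k * (u0 (vert s k)
       * x (vert s k)))));
    last by rewrite -!corner_sumZ -corner_sumD -corner_sumZ;
      apply: eq_corner_sum => s k; ring.
  rewrite -/kap (_ : corner_sum (fun s k => (kap * w (vert s k)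
      - eps^-1 * phim (u0 (vert s k))) * x (vert s k)) =
     corner_sum (fun s k => (kap * wD + eps^-1 * u0 (vert s k)) * x (vert s k)) +
     bet * corner_sum (fun s k => v (vert s k) * x (vert s k)));
    last by rewrite -corner_sumZ -corner_sumD; apply: eq_corner_sum => s k;
      rewrite /w /phim; field; rewrite !gt_eqF.
  by move=> ?; lra.
Qed.

(** The first tested equation is multiplied by [tau], the second by [k0]; as
    [k0 * kap = lambda / 2], the coupling terms cancel. *)
Lemma discrete_step_stable u w : discrete_step u w ->
  discrete_energy u w
  + tau * corner_sum (fun s k => dot (K *: dgrad s w) (dgrad s w))
  + tau * (lambda * rho / a) * (eps / c) * corner_sum (fun s k =>
      m s k * ((u (vert s k) - u0 (vert s k)) / tau) ^+ 2)
  <= discrete_energy u0 w0.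
Proof.
move=> [wN eq1 eq2].
have zN j : N j -> w j - wD = 0 by move=> /wN ->; rewrite subrr.
have := eq1 (fun j => w j - wD) zN; have := eq2 (fun j => u j - u0 j).
under [X in _ + X = 0 -> _]eq_corner_sum do rewrite dgrad_subr_cst.
set U' := corner_sum (fun s k => m s k * _ * _).
set V := corner_sum (fun s k => dot (B s k *m _) _).
set P := corner_sum (fun s k => phip _ * _).
set Q := corner_sum _.
move=> e2.
set T := corner_sum _; set Y := corner_sum _; set S := corner_sum _ => e1.
pose Z := corner_sum (fun s k => u (vert s k) - u0 (vert s k)).
pose F := corner_sum (fun s k => phim (u0 (vert s k)) *
  (u (vert s k) - u0 (vert s k))).
pose kap := 2^-1 * c * (a / alpha); pose k0 := lambda * alpha / a * c^-1.
have k0_gt0 : 0 < k0 by rewrite /k0 !mulr_gt0 ?invr_gt0.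
(* Writing [w = (w - wD) + wD] splits the coupling: [Y] meets the first equation, while [wD * Z] is
   the increment of the linear term of the energy, up to the factor [1/2] in [IE]. *)
have QE : Q = kap * (tau * Y + wD * Z) + - eps^-1 * F.
  rewrite /Q /Y /Z /F -!corner_sumZ -corner_sumD -!corner_sumZ -corner_sumD.
  by apply: eq_corner_sum => s k; rewrite /kap; field; rewrite !gt_eqF.
rewrite /discrete_energy -/S -/k0.
set X := corner_sum _; set Gu := corner_sum _; set Pu := corner_sum _.
set I := corner_sum _; set U := corner_sum _.
set X0 := corner_sum _; set G0 := corner_sum _; set P0 := corner_sum _.
set I0 := corner_sum _.
have IE : I = I0 + 2^-1 * Z.
  by rewrite -corner_sumZ -corner_sumD; apply: eq_corner_sum => s k; ring.
have UE : U' = tau * U.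
  by rewrite -corner_sumZ; apply: eq_corner_sum => s k; field; rewrite gt_eqF.
(* At each corner the defect is half the square of [w - w0]. *)
have iT : theta / 2 * X <= theta / 2 * X0 + theta * (tau * T).
  rewrite -mulrA -[in leRHS]mulrA -mulrDr ler_wpM2l //.
  rewrite -!corner_sumZ -corner_sumD; apply: ler_corner_sum => s k.
  rewrite -subr_ge0 [leRHS](_ : _ = 2^-1 * (w (vert s k) - w0 (vert s k)) ^+ 2).
    by rewrite mulr_ge0 ?invr_ge0 ?sqr_ge0.
  by field; rewrite gt_eqF.
have iV : k0 * (eps * (2^-1 * Gu)) <= k0 * (eps * (2^-1 * G0 + V)).
  rewrite ler_pM2l // ler_pM2l //.
  rewrite -!corner_sumZ -corner_sumD; apply: ler_corner_sum => s k.
  have := @B_energy s k (dgrad s u) _ erefl.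
  by rewrite dgrad_subr !expr2 => ?; lra.
have iP : k0 * (eps^-1 * Pu) <= k0 * (eps^-1 * (P0 + (P + F))).
  rewrite ler_pM2l // ler_pM2l ?invr_gt0 //.
  rewrite -!corner_sumD; apply: ler_corner_sum => s k.
  by have := Psi_energy (u (vert s k)) (u0 (vert s k)); lra.
have k0kap : k0 * kap = 2^-1 * lambda by rewrite /k0 /kap; field; rewrite !gt_eqF.
have e1' : theta * (tau * T) + 2^-1 * lambda * (tau * Y) + tau * S = 0.
  transitivity (tau * (theta * T + 2^-1 * lambda * Y + S)); first by ring.
  by rewrite e1 mulr0.
have e2' : k0 * (eps * (rho / alpha)) * (tau * U) + k0 * (eps * V)
    + k0 * (eps^-1 * P) = 2^-1 * lambda * (tau * Y + wD * Z) - k0 * (eps^-1 * F).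
  rewrite -k0kap; transitivity (k0 * Q); first by rewrite -e2 UE; ring.
  by rewrite QE; ring.
have -> : tau * (lambda * rho / a) * (eps / c) * U
    = k0 * (eps * (rho / alpha)) * (tau * U).
  by rewrite /k0; field; rewrite !gt_eqF.
by rewrite IE; lra.
Qed.

End DiscreteScheme.

(** * Equivalence of the scheme with the nodal system *)

Section Assembly.
Context (R : realType) (M : mesh R)
  (D : {set {set nodes M}}) (hD : D \subset boundary_edges M)
  (L : nat) (hL : (0 < L)%N)
  (G : 'I_L -> vec3 R -> 'M[R]_3)
  (hGcont : forall l, {within surface M, continuous (G l)})
  (hGpd : forall l z, surface M z -> sym_posdef (G l z))
  (mu : vec3 R -> vec3 R -> R)
  (hmupos : forall z q, surface M z -> 0 < mu z q)
  (hmucont : forall q, {within surface M, continuous (fun z => mu z q)})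
  (eps alpha a lambda K theta rho wD : R) (tau : R)
  (Phi0 W0 : vec3 R -> R) (hPhi0 : Sh M Phi0) (hW0 : Sh M W0).

Definition nodal (f : vec3 R -> R) : nodes M -> R := fun j => f (node j).

Lemma nodal_interp u : nodal (interp u) = u.
Proof. by apply/funext => j; exact: interp_node. Qed.

Definition dirichlet_nodes : pred (nodes M) := fun j => [exists e in D, j \in e].

(** A boundary edge is a side of some triangle, and on it [f] averages its nodal values with weights
    supported on the edge. *)
Lemma edge_union_nodes f c : Sh M f ->
  (forall x, edge_union D x -> f x = c) <->
  (forall j, dirichlet_nodes j -> nodal f j = c).
Proof.
move=> Sf; split=> [fc j /exists_inP[e eD je]|fc x [e eD xe]].
  by apply: fc; exists e => //; exact: node_hull.
have := fintype.subsetP hD e eD; rewrite finset.inE => /andP[_ /eqP e1].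
have /card_gt0P[s] : (0 < #|[pred s | e \subset verts s]|)%N by rewrite e1.
rewrite inE => es; have [t [t0 tA /(_ s es) tb]] := hull_bary xe.
have xs : closure (tri s) x.
  rewrite closure_tri; have [t1 ->] := tb; exists t; split=> [j _||] //.
    by rewrite big_verts.
  by rewrite big_verts.
rewrite (Sh_bary Sf tb xs) -[RHS]mul1r -(proj1 tb) mulr_suml.
apply: eq_bigr => k _; have [ke|/tA ->] := boolP (vert s k \in e).
  by congr (_ * _); apply: (fc (vert s k)); apply/exists_inP; exists e.
by rewrite !mul0r.
Qed.

Let mu0 (s : triangles M) (k : 'I_3) : R := mu (corner s k) (dgrad s (nodal Phi0)).
Let B0 (s : triangles M) (k : 'I_3) := Bmx G (corner s k) (dgrad s (nodal Phi0)).
Let gam0 (s : triangles M) (k : 'I_3) := gamma G (corner s k).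

Lemma has_trace_mu s k :
  has_trace s k (fun x => mu x (sgrad M Phi0 x)) (mu0 s k).
Proof.
apply: (@has_trace_sgrad _ _ _ _ mu) => //.
have := @has_trace_continuous _ _ s k (fun x => mu x (dgrad s (nodal Phi0))).
by apply; exact: hmucont.
Qed.

Lemma inner_quotient f g h : Sh M f -> Sh M g -> Sh M h ->
  inner M (fun x => (f x - g x) / tau) h = corner_sum (fun s k =>
    (nodal f (vert s k) - nodal g (vert s k)) / tau * nodal h (vert s k)).
Proof.
move=> Sf Sg S_h; apply: innerE => s k; last exact: has_trace_Sh.
apply: has_traceM; last exact: has_trace_cst.
by apply: has_traceB; exact: has_trace_Sh.
Qed.

Lemma innerv_sgrad f h : Sh M f -> Sh M h ->
  innerv M (fun x => K *: sgrad M f x) (sgrad M h) =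
  corner_sum (fun s k => dot (K *: dgrad s (nodal f)) (dgrad s (nodal h))).
Proof.
move=> Sf S_h; apply: lumpedE => s k.
apply: (@has_trace_eq _ _ _ _ _
  (fun=> dot (K *: dgrad s (nodal f)) (dgrad s (nodal h)))).
  by move=> x xs; rewrite !(sgrad_dgrad _ xs).
exact: has_trace_cst.
Qed.

Lemma inner_mu f h : Sh M f -> Sh M h ->
  inner M (fun x => mu x (sgrad M Phi0 x) * ((f x - Phi0 x) / tau)) h =
  corner_sum (fun s k => mu0 s k * ((nodal f (vert s k) - nodal Phi0 (vert s k))
    / tau) * nodal h (vert s k)).
Proof.
move=> Sf S_h; apply: innerE => s k; last exact: has_trace_Sh.
apply: has_traceM; first exact: has_trace_mu.
apply: has_traceM; last exact: has_trace_cst.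
by apply: has_traceB; exact: has_trace_Sh.
Qed.

Lemma innerv_Bmx f h : Sh M f -> Sh M h ->
  innerv M (fun x => Bmx G x (sgrad M Phi0 x) *m sgrad M f x) (sgrad M h) =
  corner_sum (fun s k => dot (B0 s k *m dgrad s (nodal f)) (dgrad s (nodal h))).
Proof.
move=> Sf S_h; apply: lumpedE => s k.
apply: (@has_trace_eq _ _ _ _ _ (fun x => dot (Bmx G x (dgrad s (nodal Phi0))
  *m dgrad s (nodal f)) (dgrad s (nodal h)))).
  by move=> x xs; rewrite !(sgrad_dgrad _ xs).
exact: has_trace_Bmx.
Qed.

Lemma inner_phip f h : Sh M f -> Sh M h -> inner M (fun x => phip (f x)) h =
  corner_sum (fun s k => phip (nodal f (vert s k)) * nodal h (vert s k)).
Proof.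
move=> Sf S_h; apply: innerE => s k; last exact: has_trace_Sh.
by apply: has_traceX; exact: has_trace_Sh.
Qed.

Lemma inner_rhs f h (b d : R) : Sh M f -> Sh M h ->
  inner M (fun x => b * f x - d * phim (Phi0 x)) h =
  corner_sum (fun s k => (b * nodal f (vert s k) - d * phim (nodal Phi0 (vert s k)))
    * nodal h (vert s k)).
Proof.
move=> Sf S_h; apply: innerE => s k; last exact: has_trace_Sh.
apply: has_traceB; apply: has_traceM; try exact: has_trace_cst.
  exact: has_trace_Sh.
under eq_fun do rewrite /phim -sub0r; rewrite /phim -sub0r.
by apply: has_traceB; [exact: has_trace_cst | exact: has_trace_Sh].
Qed.

Let dstep := discrete_step dirichlet_nodes mu0 B0 eps alpha a lambda K theta rho
  wD tau (cPsi R) (nodal Phi0) (nodal W0).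

(** Traces turn every product into a corner sum of nodal values, and [interp] makes every nodal
    vector a test function. *)
Lemma scheme_stepP Phi W :
  scheme_step D G mu eps alpha a lambda K theta rho wD tau Phi0 W0 Phi W <->
  [/\ Sh M Phi, Sh M W & dstep (nodal Phi) (nodal W)].
Proof.
split=> [[SP [SW Wbc] eq1 eq2]|[SP SW [Wbc eq1 eq2]]].
  split=> //; split=> [|x xN|x].
  - exact/edge_union_nodes.
  - have SX := interp_Sh x; have := eq1 (interp x); rewrite inner_quotient //.
    rewrite inner_quotient // innerv_sgrad // nodal_interp; apply; split=> //.
    by apply/edge_union_nodes => //; rewrite nodal_interp.
  - have SX := interp_Sh x; have := eq2 (interp x) SX.
    by rewrite inner_mu // innerv_Bmx // inner_phip // inner_rhs // nodal_interp.
split=> //; first by split=> //; exact/edge_union_nodes.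
- move=> h [S_h hbc]; rewrite !inner_quotient // innerv_sgrad //; apply: eq1.
  exact/edge_union_nodes.
- by move=> h S_h; rewrite inner_mu // innerv_Bmx // inner_phip // inner_rhs.
Qed.

Lemma normh_sqr f h : (forall (s : triangles M) k, has_trace s k f (h s k)) ->
  normh M f ^+ 2 = corner_sum (fun s k => h s k * h s k).
Proof.
move=> fh; rewrite /normh (innerE fh fh) sqr_sqrtr //.
by apply: corner_sum_ge0 => s k; rewrite -expr2 sqr_ge0.
Qed.

Lemma FhE W Phi : Sh M W -> Sh M Phi ->
  Fh M G eps alpha a lambda theta wD W Phi =
  discrete_energy gam0 eps alpha a lambda theta wD (cPsi R) (nodal Phi) (nodal W).
Proof.
move=> SW SP; rewrite /Fh /Eh /discrete_energy.
rewrite (@normh_sqr _ (fun s k => nodal W (vert s k) - wD)); last first.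
  by move=> s k; apply: has_traceB; [exact: has_trace_Sh | exact: has_trace_cst].
rewrite (@normh_sqr _ (fun s k => gam0 s k (dgrad s (nodal Phi)))); last first.
  by move=> s k; apply: (@has_trace_sgrad _ _ _ _ (gamma G)) => //; exact: has_trace_gamma.
rewrite (@innerE _ _ _ _ (fun s k => Psi (nodal Phi (vert s k))) (fun _ _ => 1)).
- rewrite (@innerE _ _ _ _ (fun _ _ => 2^-1)
    (fun s k => 1 + nodal Phi (vert s k))) // => s k.
    exact: has_trace_cst.
  by apply: has_traceD; [exact: has_trace_cst | exact: has_trace_Sh].
- move=> s k; apply: has_traceM; first exact: has_trace_cst.
  apply: has_traceX; apply: has_traceB; first exact: has_trace_cst.
  by apply: has_traceX; exact: has_trace_Sh.
- by move=> s k; exact: has_trace_cst.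
Qed.

Lemma normh_mu f : Sh M f ->
  normh M (fun x => Num.sqrt (mu x (sgrad M Phi0 x)) * ((f x - Phi0 x) / tau)) ^+ 2
  = corner_sum (fun s k => mu0 s k *
      ((nodal f (vert s k) - nodal Phi0 (vert s k)) / tau) ^+ 2).
Proof.
move=> Sf; rewrite (@normh_sqr _ (fun s k => Num.sqrt (mu0 s k) *
    ((nodal f (vert s k) - nodal Phi0 (vert s k)) / tau))).
  apply: eq_corner_sum => s k; rewrite -expr2 exprMn sqr_sqrtr // ltW //.
  exact/hmupos/closure_tri_surface/corner_closure.
move=> s k; apply: has_traceM; first exact/has_trace_sqrt/has_trace_mu.
apply: has_traceM; last exact: has_trace_cst.
by apply: has_traceB; exact: has_trace_Sh.
Qed.

Lemma scheme_step_well_posed_stable : 0 < eps -> 0 < alpha -> 0 < a ->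
  0 < lambda -> 0 < K -> 0 <= theta -> 0 <= rho -> 0 < tau ->
  exists Phi W : vec3 R -> R,
    [/\ scheme_step D G mu eps alpha a lambda K theta rho wD tau Phi0 W0 Phi W,
        forall Phi' W' : vec3 R -> R,
          scheme_step D G mu eps alpha a lambda K theta rho wD tau Phi0 W0
            Phi' W' ->
          forall x, surface M x -> Phi' x = Phi x /\ W' x = W x
      & Fh M G eps alpha a lambda theta wD W Phi
        + tau * innerv M (fun x => K *: sgrad M W x) (sgrad M W)
        + tau * (lambda * rho / a) * (eps / cPsi R)
          * normh M (fun x => Num.sqrt (mu x (sgrad M Phi0 x))
                              * ((Phi x - Phi0 x) / tau)) ^+ 2
        <= Fh M G eps alpha a lambda theta wD W0 Phi0].
Proof.
move=> heps halpha ha hlambda hK htheta hrho htau.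
have c0 := cPsi_gt0 R.
have pd s k l : sym_posdef (G l (@corner _ M s k)).
  exact/hGpd/closure_tri_surface/corner_closure.
have mu_gt0 s k : 0 < mu0 s k.
  exact/hmupos/closure_tri_surface/corner_closure.
have B_sym s k p q : dot (B0 s k *m p) q = dot (B0 s k *m q) p.
  exact: dot_Bmx_sym.
have B_ge0 s k p : 0 <= dot (B0 s k *m p) p by exact: dot_Bmx_ge0.
have B_en s k p q : q = dgrad s (nodal Phi0) ->
    2^-1 * gam0 s k p ^+ 2 - 2^-1 * gam0 s k q ^+ 2 <= dot (B0 s k *m p) (p - q).
  by move=> ->; exact: Bmx_energy.
have [u [w uw]] : exists u w, dstep u w by exact: discrete_step_exists.
exists (interp u), (interp w).
have SU := interp_Sh u; have SW := interp_Sh w; split.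
- by apply/scheme_stepP; rewrite !nodal_interp.
- move=> P' W' /scheme_stepP[SP' SW' step'] x xM.
  have [uP wW] : nodal P' = u /\ nodal W' = w.
    exact: (discrete_step_unique heps halpha ha hlambda hK htheta hrho htau c0
      mu_gt0 B_ge0 uw step').
  split; apply: (@Sh_eq_on_surface R M) => // j; rewrite interp_node.
    by rewrite -uP.
  by rewrite -wW.
- rewrite !FhE // innerv_sgrad // normh_mu // !nodal_interp.
  exact: (discrete_step_stable heps halpha ha hlambda htheta htau c0 B_en uw).
Qed.

End Assembly.

Lemma Sh_cst (R : realType) (M : mesh R) (c : R) : Sh M (fun=> c).
Proof.
split=> [|s]; first exact/continuous_subspaceT/continuous_cstf.
by exists 0, c => x _; rewrite dot0l add0r.
Qed.

(** Allows an arbitrary [W0] to be exchanged for a finite element function. *)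
Lemma scheme_step_theta0 (R : realType) (M : mesh R) (D : {set {set nodes M}})
    (L : nat) (G : 'I_L -> vec3 R -> 'M[R]_3) (mu : vec3 R -> vec3 R -> R)
    (eps alpha a lambda K rho wD tau : R) (Phi0 W0 W1 Phi W : vec3 R -> R) :
  scheme_step D G mu eps alpha a lambda K 0 rho wD tau Phi0 W0 Phi W ->
  scheme_step D G mu eps alpha a lambda K 0 rho wD tau Phi0 W1 Phi W.
Proof.
by move=> [SP SW eq1 eq2]; split=> // chi /eq1; rewrite !mul0r.
Qed.

Theorem theorem4p3 (R : realType) (M : mesh R)
  (D : {set {set nodes M}}) (hD : D \subset boundary_edges M)
  (L : nat) (hL : (1 <= L)%N)
  (G : 'I_L -> vec3 R -> 'M[R]_3)
  (hGcont : forall l, {within surface M, continuous (G l)})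
  (hGpd : forall l z, surface M z -> sym_posdef (G l z))
  (mu : vec3 R -> vec3 R -> R)
  (hmupos : forall z q, surface M z -> 0 < mu z q)
  (hmucont : forall q, {within surface M, continuous (fun z => mu z q)})
  (eps alpha a lambda K theta rho wD : R)
  (heps : 0 < eps) (halpha : 0 < alpha) (ha : 0 < a) (hlambda : 0 < lambda)
  (hK : 0 < K) (htheta : 0 <= theta) (hrho : 0 <= rho)
  (n : nat) (hn : (1 <= n)%N) (tau : R) (htau : 0 < tau)
  (Phi0 W0 : vec3 R -> R)
  (hPhi0 : Sh M Phi0) (hPhi0K : n = 1%N -> Kh M Phi0)
  (hW0 : 0 < theta -> Sh_bc D wD W0) :
  exists Phi W : vec3 R -> R,
    [/\ scheme_step D G mu eps alpha a lambda K theta rho wD tau Phi0 W0 Phi W,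
        forall Phi' W' : vec3 R -> R,
          scheme_step D G mu eps alpha a lambda K theta rho wD tau Phi0 W0
            Phi' W' ->
          forall x, surface M x -> Phi' x = Phi x /\ W' x = W x
      & Fh M G eps alpha a lambda theta wD W Phi
        + tau * innerv M (fun x => K *: sgrad M W x) (sgrad M W)
        + tau * (lambda * rho / a) * (eps / cPsi R)
          * normh M (fun x => Num.sqrt (mu x (sgrad M Phi0 x))
                              * ((Phi x - Phi0 x) / tau)) ^+ 2
        <= Fh M G eps alpha a lambda theta wD W0 Phi0].
Proof.
have [theta0|theta_gt0] : theta = 0 \/ 0 < theta.
  by move: htheta; rewrite le_eqVlt eq_sym => /orP[/eqP|]; [left | right].
(* For [theta = 0] nothing is known about [W0], so the constant [wD] takes its place; the scheme and
   the energies do not see the change. *)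
- have := @scheme_step_well_posed_stable R M D hD L hL G hGcont hGpd mu hmupos
    hmucont eps alpha a lambda K theta rho wD tau Phi0 (fun=> wD) hPhi0 (Sh_cst M wD)
    heps halpha ha hlambda hK htheta hrho htau.
  move=> [Phi [W [step uniq stable]]]; exists Phi, W; subst theta; split.
  + exact: scheme_step_theta0 step.
  + by move=> P' W' step' x xM; apply: uniq xM; exact: scheme_step_theta0 step'.
  + by move: stable; rewrite /Fh /Eh !mul0r.
- have [SW0 _] := hW0 theta_gt0.
  exact: scheme_step_well_posed_stable.
Qed.
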